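(* Let $\mathfrak g$ be a finite-dimensional real vector space with a fixed inner product $\langle\cdot,\cdot\rangle$ and an LSA structure, and let $\theta_0(X)=-L(X)^t$. Then the SCF on the class of almost-Kähler Lie algebras $(\mathfrak g\ltimes_\theta\mathfrak g,\omega,g)$ is equivalent to the following ODE for $\theta=\theta(t):\mathfrak g\to\operatorname{End}(\mathfrak g)$: $$\theta'(X)=\theta((P_1+S)X)+[\theta(X),P_1^t-S],\qquad\forall X\in\mathfrak g,$$ where $P=\begin{bmatrix}P_1&0\\0&P_1^t\end{bmatrix}$ and $\mathrm{Ric}^{ac}=\begin{bmatrix}S&0\\0&-S\end{bmatrix}$ are respectively the Chern-Ricci operator and the anti-$J$-invariant part of the Ricci operator of $(\mathfrak g\ltimes_{\theta(t)}\mathfrak g,\omega,g)$. That is, the bracket flow solution $\mu(t)$ starting at the Lie bracket of $\mathfrak g\ltimes_{\theta_0}\mathfrak g$ is, for every $t$, the Lie bracket of $\mathfrak g\ltimes_{\theta(t)}\mathfrak g$, where $\theta(t)$ is the solution of this ODE with $\theta(0)=\theta_0$ and the bracket on the first factor is $\lambda(t)(X,Y)=-\theta(t)(X)^tY+\theta(t)(Y)^tX$.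
   Context: An LSA (left-symmetric algebra) structure on $\mathfrak g$ is a bilinear product with $X\cdot(Y\cdot Z)-(X\cdot Y)\cdot Z=Y\cdot(X\cdot Z)-(Y\cdot X)\cdot Z$. Then $[X,Y]_{\mathfrak g}=X\cdot Y-Y\cdot X$ is a Lie bracket; $L(X)Y=X\cdot Y$, $\theta(X)=-L(X)^t$ (transpose with respect to $\langle\cdot,\cdot\rangle$), so that $[X,Y]_{\mathfrak g}=-\theta(X)^tY+\theta(Y)^tX$. The Lie algebra $\mathfrak g\ltimes_\theta\mathfrak g$ is $\mathfrak g\oplus\mathfrak g$ with bracket $[(X,Y),(Z,W)]=([X,Z]_{\mathfrak g},\theta(X)W-\theta(Z)Y)$. It carries the fixed data $g=\langle\cdot,\cdot\rangle\oplus\langle\cdot,\cdot\rangle$, $J(X,Y)=(Y,-X)$, $\omega=g(J\cdot,\cdot)$, and is almost-Kähler ($\omega$ is closed). For an almost-Kähler Lie algebra $(\mathfrak h,\mu,\omega,g)$ with bracket $\mu$: the Chern-Ricci form is $p(X,Y)=-\frac12\operatorname{tr}(J\operatorname{ad}\mu(X,Y))+\frac12\operatorname{tr}(\operatorname{ad}J\mu(X,Y))$, the Chern-Ricci operator $P_\mu$ is defined by $p=\omega(P_\mu\cdot,\cdot)$, $\mathrm{Ric}_\mu$ is the Ricci operator of $g$, and $\mathrm{Ric}_\mu^{ac}=\frac12(\mathrm{Ric}_\mu+J\mathrm{Ric}_\mu J)$. The SCF (symplectic curvature flow) for left-invariant structures is $\frac{d}{dt}\omega=-2p$, $\frac{d}{dt}g=-2p^{c}(\cdot,J\cdot)-2\mathrm{Rc}^{ac}$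 ($p^{c}=\frac12(p+p(J\cdot,J\cdot))$, $\mathrm{Rc}^{ac}=\frac12(\mathrm{Rc}-\mathrm{Rc}(J\cdot,J\cdot))$, $\mathrm{Rc}$ the Ricci tensor). It is known to be equivalent to the bracket flow $\frac{d}{dt}\mu=\delta_\mu(P_\mu+\mathrm{Ric}^{ac}_\mu)$, with $(\omega,g)$ fixed and $\delta_\mu(E)=\mu(E\cdot,\cdot)+\mu(\cdot,E\cdot)-E\mu(\cdot,\cdot)$: both have the same maximal interval, and the SCF solution starting at $(\omega,g)$ on the Lie group with bracket $\mu(0)$ is the pullback of $(\omega,g)$ by isomorphisms onto the Lie groups with bracket $\mu(t)$. *)

(* Defs.v *)
From HB Require Import structures.
From mathcomp Require Import all_boot all_order all_algebra.
From mathcomp Require Import all_classical all_reals all_analysis.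
From mathcomp Require Export sesquilinear.

Set Implicit Arguments.
Unset Strict Implicit.
Unset Printing Implicit Defensive.

Import Order.TTheory GRing.Theory Num.Theory.
Import numFieldNormedType.Exports.

Local Open Scope classical_set_scope.
Local Open Scope ring_scope.

(* A bilinear product (in particular a bracket) on W is an element mu of
   'Hom(W, 'End(W)); the product of x and y is mu x y, so that the
   endomorphism mu x is left multiplication by x (ad x for a bracket). *)

Section LinearAlgebra.
Variables (R : realType) (W : vectType R).

Definition lftrace (f : 'End(W)) : R :=
  \tr (passmx.mxof (vbasis {:W}) (vbasis {:W}) f).

(* The endomorphism E with b (E x) y = phi x y for all x and y. It exists and is
   unique when b is a nondegenerate bilinear form and phi is bilinear. *)
Definition form_op (b phi : W -> W -> R) : 'End(W) :=
  xget 0 [set E : 'End(W) | forall x y, b (E x) y = phi x y].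

Definition adjoint (b : W -> W -> R) (f : 'End(W)) : 'End(W) :=
  form_op b (fun x y => b x (f y)).

(* The curve c is differentiable at t with derivative w. As W is
   finite-dimensional, testing against all linear forms amounts to
   differentiability for any norm on W. *)
Definition is_vderive (t : R) (c : R -> W) (w : W) : Prop :=
  forall f : 'Hom(W, R^o), is_derive t (1 : R) (fun s => f (c s) : R^o) (f w).

End LinearAlgebra.

Section MetricBracket.
Variables (R : realType) (W : vectType R).
Variables (g : W -> W -> R) (J : 'End(W)) (mu : 'Hom(W, 'End(W))).

Definition fundamental_form (x y : W) : R := g (J x) y.

(* mu is a Lie bracket and d omega = 0 for the left-invariant form
   omega = g(J., .). That J is orthogonal with square -1 is not restated: it
   holds for the fixed pair (double_metric, double_J) below. *)
Definition almost_kahler : Prop :=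
  [/\ forall x, mu x x = 0,
      forall x y z, mu x (mu y z) + mu y (mu z x) + mu z (mu x y) = 0
    & forall x y z, fundamental_form (mu x y) z + fundamental_form (mu y z) x
                    + fundamental_form (mu z x) y = 0].

(* Levi-Civita connection of the left-invariant metric g, by Koszul's formula *)
Definition nabla (x : W) : 'End(W) :=
  form_op g (fun y z => 2^-1 * (g (mu x y) z - g (mu y z) x + g (mu z x) y)).

Definition curvature (x y : W) : 'End(W) :=
  (nabla x \o nabla y)%VF - (nabla y \o nabla x)%VF - nabla (mu x y).

Definition ricci_tensor (y z : W) : R :=
  lftrace (linfun (fun x => curvature x y z)).

Definition ricci_op : 'End(W) := form_op g ricci_tensor.

Definition ricci_ac : 'End(W) :=
  2^-1 *: (ricci_op + (J \o ricci_op \o J)%VF).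

Definition chern_ricci_form (x y : W) : R :=
  - (2^-1 * lftrace (J \o mu (mu x y))%VF) + 2^-1 * lftrace (mu (J (mu x y))).

Definition chern_ricci_op : 'End(W) :=
  form_op fundamental_form chern_ricci_form.

Definition delta (E : 'End(W)) (x y : W) : W :=
  mu (E x) y + mu x (E y) - E (mu x y).

End MetricBracket.

(* No Lie condition is imposed on mu t: the equation makes sense on all bilinear
   maps, and the Jacobi identity is preserved by it. *)
Definition bracket_flow (R : realType) (W : vectType R) (g : W -> W -> R)
    (J : 'End(W)) (I : set R) (mu : R -> 'Hom(W, 'End(W))) : Prop :=
  forall t, I t -> forall x y,
    is_vderive t (fun s => mu s x y)
      (delta (mu t) (chern_ricci_op g J (mu t) + ricci_ac g J (mu t)) x y).

Definition left_symmetric (R : realType) (V : vectType R)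
    (L : 'Hom(V, 'End(V))) : Prop :=
  forall x y z, L x (L y z) - L (L x y) z = L y (L x z) - L (L y x) z.

Section DoubleAlgebra.
Variables (R : realType) (V : vectType R) (ip : V -> V -> R).

Definition dual_rep (L : 'Hom(V, 'End(V))) : 'Hom(V, 'End(V)) :=
  linfun (fun X => - adjoint ip (L X)).

Definition double_metric (x y : V * V) : R := ip x.1 y.1 + ip x.2 y.2.

Definition double_J : 'End((V * V)%type) :=
  linfun (fun x : V * V => (x.2, - x.1)).

(* lambda = [., .]_g *)
Definition base_bracket (theta : 'Hom(V, 'End(V))) (X Y : V) : V :=
  - adjoint ip (theta X) Y + adjoint ip (theta Y) X.

Definition semidirect_bracket (theta : 'Hom(V, 'End(V))) :
    'Hom((V * V)%type, 'End((V * V)%type)) :=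
  linfun (fun x : V * V => linfun (fun z : V * V =>
    (base_bracket theta x.1 z.1, theta x.1 z.2 - theta z.1 x.2))).

Definition block_diag (A B : 'End(V)) : 'End((V * V)%type) :=
  linfun (fun x : V * V => (A x.1, B x.2)).

Definition ul_block (E : 'End((V * V)%type)) : 'End(V) :=
  linfun (fun X : V => (E (X, 0)).1).

Definition double_P (theta : 'Hom(V, 'End(V))) : 'End((V * V)%type) :=
  chern_ricci_op double_metric double_J (semidirect_bracket theta).

Definition double_ricci_ac (theta : 'Hom(V, 'End(V))) :
    'End((V * V)%type) :=
  ricci_ac double_metric double_J (semidirect_bracket theta).

Definition P1 (theta : 'Hom(V, 'End(V))) : 'End(V) :=
  ul_block (double_P theta).

Definition S1 (theta : 'Hom(V, 'End(V))) : 'End(V) :=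
  ul_block (double_ricci_ac theta).

Definition lf_commutator (A B : 'End(V)) : 'End(V) :=
  (A \o B)%VF - (B \o A)%VF.

Definition theta_flow (I : set R) (theta : R -> 'Hom(V, 'End(V))) : Prop :=
  forall t, I t -> forall X,
    is_vderive t (fun s => theta s X)
      (theta t ((P1 (theta t) + S1 (theta t)) X)
       + lf_commutator (theta t X)
           (adjoint ip (P1 (theta t)) - S1 (theta t))).

End DoubleAlgebra.

(* Main.v *)
(** The proof is a computation with multilinear maps combined with Gronwall's
    lemma. The reflection [(X, Y) |-> (X, - Y)] is an isometric automorphism of
    every semidirect bracket and anticommutes with [J], so the Chern-Ricci and
    Ricci operators are block diagonal. The bracket flow field is tangent to the
    space of semidirect brackets only where the Jacobi identity holds: the defect
    is linear in the Jacobiator, through the curvature of [theta] and the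
    antisymmetric part of the Ricci tensor. Along the bracket flow the Jacobiator
    solves a linear equation, hence stays zero. Uniqueness and invariance
    statements all take the same form: a curve [c] with [c 0 = 0] and
    [c' = O(c)] vanishes, so the identities for [c'] need only be checked modulo
    [O(c)]. *)

Require Import Defs.
From HB Require Import structures.
From mathcomp Require Import all_boot all_order all_algebra.
From mathcomp Require Import all_classical all_reals all_analysis.
From mathcomp Require Import ring lra.

Set Implicit Arguments.
Unset Strict Implicit.
Unset Printing Implicit Defensive.

Import Order.TTheory GRing.Theory Num.Theory.
Import numFieldNormedType.Exports.

Local Open Scope classical_set_scope.
Local Open Scope ring_scope.

(** The obstacle is a circle. A solution [theta] yields brackets obeying the bracket flow where
    these are Lie, whereas the linear equation for the Jacobiator is derived from the bracket flow.
    It is broken by an error estimate: the bracket flow holds up to O(Jacobiator) for every [theta],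
    and such an error is absorbed by the linear equation. Where the defect comes from: for
    [P + Ric^ac = diag(A, D)] the first factor would follow the bracket flow at once if [D = - A^t].
    In fact [D^t + A = 2 P_1 + (S - S^t)]; the first summand contributes the curvature of [theta],
    the second the failure of the Ricci tensor to be symmetric. Conversely a solution [mu] of the
    bracket flow is compared with its linear projection [semidirect_bracket (extract mu)]. Thus
    [theta] is read off [mu], and the existence claim rests on no existence theorem for differential
    equations. The relation [cong] stands in for Lipschitz estimates: all tensors involved are
    polynomial in the bracket, so stability under sums, linear maps and evaluation is enough. *)

Section LinearMaps.
Variable R : realType.
Implicit Types U V W : vectType R.

(** A predicate on bare functions, because tensors with some arguments fixed come as functions;
    [linfun] agrees with such a function once its linearity is known. *)
Definition is_lin U V (f : U -> V) : Prop :=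
  forall a x y, f (a *: x + y) = a *: f x + f y.

Lemma is_lin_linear U V (f : {linear U -> V}) : is_lin f.
Proof. by move=> a x y; rewrite linearP. Qed.

Lemma is_lin_lfun U V (f : 'Hom(U, V)) : is_lin f.
Proof. exact: is_lin_linear. Qed.

Lemma lfun_linE U V (f : U -> V) : is_lin f -> linfun f =1 f.
Proof.
move=> lf; pose F : {linear U -> V} :=
  HB.pack f (GRing.isLinear.Build R U V _ f lf).
exact: (lfunE F).
Qed.

Section IsLinTheory.
Variables (U V W : vectType R) (f g : U -> V).
Hypotheses (lf : is_lin f) (lg : is_lin g).

Lemma is_lin0 : f 0 = 0.
Proof. by rewrite -(lfun_linE lf) linear0. Qed.

Lemma is_linD x y : f (x + y) = f x + f y.
Proof. by rewrite -!(lfun_linE lf) linearD. Qed.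

Lemma is_linN x : f (- x) = - f x.
Proof. by rewrite -!(lfun_linE lf) linearN. Qed.

Lemma is_linB x y : f (x - y) = f x - f y.
Proof. by rewrite -!(lfun_linE lf) linearB. Qed.

Lemma is_linZ a x : f (a *: x) = a *: f x.
Proof. by rewrite -!(lfun_linE lf) linearZ. Qed.

Lemma is_lin_sum I (r : seq I) (P : pred I) (E : I -> U) :
  f (\sum_(i <- r | P i) E i) = \sum_(i <- r | P i) f (E i).
Proof.
by rewrite -(lfun_linE lf) linear_sum; apply: eq_bigr => i _; exact: lfun_linE.
Qed.

Lemma is_lin_add : is_lin (fun x => f x + g x).
Proof. by move=> a x y; rewrite lf lg scalerDr addrACA. Qed.

Lemma is_lin_opp : is_lin (fun x => - f x).
Proof. by move=> a x y; rewrite lf opprD scalerN. Qed.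

Lemma is_lin_scale c : is_lin (fun x => c *: f x).
Proof. by move=> a x y; rewrite lf scalerDr !scalerA mulrC. Qed.

End IsLinTheory.

Lemma is_lin_sub U V (f g : U -> V) :
  is_lin f -> is_lin g -> is_lin (fun x => f x - g x).
Proof. by move=> lf lg; apply: is_lin_add => //; apply: is_lin_opp. Qed.

Lemma is_lin_id U : is_lin (fun x : U => x).
Proof. by move=> a x y. Qed.

Lemma is_lin_fst U V W (f : U -> (V * W)%type) :
  is_lin f -> is_lin (fun x => (f x).1).
Proof. by move=> lf a x y; rewrite lf. Qed.

Lemma is_lin_app U V W (f : U -> 'Hom(V, W)) v :
  is_lin f -> is_lin (fun x => f x v).
Proof. by move=> lf a x y; rewrite lf add_lfunE scale_lfunE. Qed.

Lemma is_lin_hom U V W (f : U -> V -> W) :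
  (forall x, is_lin (f x)) -> (forall y, is_lin (f^~ y)) ->
  is_lin (fun x => linfun (f x)).
Proof.
move=> l1 l2 a x y; apply/lfunP => v.
by rewrite add_lfunE scale_lfunE !lfun_linE// l2.
Qed.

Definition bilin U V W (f : U -> V -> W) : Prop :=
  (forall x, is_lin (f x)) /\ (forall y, is_lin (f^~ y)).

Definition bilin_lfun U V W (f : U -> V -> W) : 'Hom(U, 'Hom(V, W)) :=
  linfun (fun x => linfun (f x)).

Lemma bilin_lfunE U V W (f : U -> V -> W) x y : bilin f -> bilin_lfun f x y = f x y.
Proof.
by case=> l1 l2; rewrite /bilin_lfun lfun_linE ?lfun_linE//; exact: is_lin_hom.
Qed.

Definition bcoord W : 'I_(\dim {:W}) -> W -> R := coord (vbasis {:W}).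
Definition bvec W (i : 'I_(\dim {:W})) : W := (vbasis {:W})`_i.

Lemma bcoordP W (v : W) : v = \sum_i bcoord i v *: bvec i.
Proof. by rewrite [LHS](coord_vbasis (memvf v)). Qed.

Lemma is_lin_coord W i : is_lin (@bcoord W i : W -> R^o).
Proof. by move=> a x y; exact: (@coord_is_scalar _ _ _ (vbasis {:W}) i a x y). Qed.

Lemma lin_expand U V (f : U -> V) x :
  is_lin f -> f x = \sum_i bcoord i x *: f (bvec i).
Proof.
move=> lf; rewrite {1}(bcoordP x) is_lin_sum//.
by apply: eq_bigr => i _; rewrite is_linZ.
Qed.

Lemma form_ext W (x y : W) : (forall f : 'Hom(W, R^o), f x = f y) -> x = y.
Proof.
move=> h; rewrite (bcoordP x) (bcoordP y); apply: eq_bigr => i _; congr (_ *: _).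
by have := h (linfun (bcoord i)); rewrite !(lfun_linE (@is_lin_coord W i)).
Qed.

Lemma lftrace_is_lin W : is_lin (@lftrace R W : 'End(W) -> R^o).
Proof.
move=> a f g; rewrite /lftrace.
have -> : passmx.mxof (vbasis {:W}) (vbasis {:W}) (a *: f + g) =
    a *: passmx.mxof (vbasis {:W}) (vbasis {:W}) f
    + passmx.mxof (vbasis {:W}) (vbasis {:W}) g.
  exact: passmx.mxof_linear.
by rewrite mxtraceD mxtraceZ.
Qed.

Lemma lftraceC W (f g : 'End(W)) : lftrace (f \o g)%VF = lftrace (g \o f)%VF.
Proof.
rewrite /lftrace !(@passmx.mxof_comp _ _ _ _ _ (vbasis {:W})) ?vbasisP//.
exact: mxtrace_mulC.
Qed.

End LinearMaps.

(** * Nondegenerate forms, adjoints and traces of skew operators *)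

Section InnerProduct.
Variables (R : realType) (W : vectType R).

Definition bform (b : W -> W -> R) : Prop := bilin (b : W -> W -> R^o).

Definition nondegenerate (b : W -> W -> R) : Prop :=
  forall x, (forall y, b x y = 0) -> x = 0.

Definition inner_product (g : W -> W -> R) : Prop :=
  [/\ bform g, forall x y, g x y = g y x & forall x, x != 0 -> 0 < g x x].

Lemma inner_product_nondeg g : inner_product g -> nondegenerate g.
Proof.
by case=> _ _ pos x gx; apply/eqP; apply: contraTT isT => /pos; rewrite gx ltxx.
Qed.

Lemma dual_dim : \dim {: 'Hom(W, R^o)} = \dim {:W}.
Proof. by rewrite !dimvf /dim /= muln1. Qed.

Section Nondegenerate.
Variable b : W -> W -> R.
Hypotheses (bb : bform b) (nb : nondegenerate b).

Lemma nondeg_inj x x' : (forall y, b x y = b x' y) -> x = x'.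
Proof.
move=> h; apply/eqP; rewrite -subr_eq0; apply/eqP; apply: nb => y.
have := is_linB (bb.2 y) x x'; rewrite /= => ->; rewrite h.
by rewrite -[LHS]/(b x' y - b x' y) subrr.
Qed.

Let Phi : 'Hom(W, 'Hom(W, R^o)) := bilin_lfun (b : W -> W -> R^o).

Let PhiE x y : Phi x y = b x y. Proof. by rewrite bilin_lfunE. Qed.

Let kerPhi : lker Phi == 0%VS.
Proof. by apply/lker0P => x y h; apply: nondeg_inj => z; rewrite -!PhiE h. Qed.

Let imgPhi : limg Phi = fullv.
Proof.
apply/eqP; rewrite eqEdim subvf /= dual_dim limg_dim_eq//.
by rewrite (eqP kerPhi) capv0.
Qed.

(** Riesz representation: [Phi] is injective into the dual space, which has the same dimension,
    hence onto. *)
Lemma form_rep (f : W -> R) :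
  is_lin (f : W -> R^o) -> {x | forall y, b x y = f y}.
Proof.
move=> lf; exists ((Phi^-1)%VF (linfun (f : W -> R^o))) => y.
by rewrite -PhiE limg_lfunVK ?imgPhi ?memvf// lfun_linE.
Qed.

Lemma form_opP (phi : W -> W -> R) x y :
  bform phi -> b (form_op b phi x) y = phi x y.
Proof.
move=> bp; rewrite /form_op; case: xgetP => [E _ //|/= none].
have Psi : is_lin (fun x => linfun (phi x : W -> R^o)).
  exact: is_lin_hom bp.1 bp.2.
(* The default value of [xget] never occurs: composing [phi], read as a map into the dual, with the
   inverse of [Phi] gives a witness. *)
case: (none (Phi^-1 \o linfun (fun x => linfun (phi x : W -> R^o)))%VF) => u v.
rewrite -PhiE comp_lfunE limg_lfunVK ?imgPhi ?memvf// lfun_linE// lfun_linE//.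
exact: bp.1.
Qed.

End Nondegenerate.

Section Metric.
Variables (g : W -> W -> R) (ig : inner_product g).

Lemma metricC x y : g x y = g y x. Proof. by case: ig. Qed.
Lemma gbform : bform g. Proof. by case: ig. Qed.
Lemma gnondeg : nondegenerate g. Proof. exact: inner_product_nondeg. Qed.
Lemma glinr x : is_lin (g x : W -> R^o). Proof. exact: gbform.1. Qed.
Lemma glinl y : is_lin (g^~ y : W -> R^o). Proof. exact: gbform.2. Qed.

Lemma gDl x y z : g (x + y) z = g x z + g y z.
Proof. exact: is_linD (glinl z) x y. Qed.
Lemma gDr x y z : g z (x + y) = g z x + g z y.
Proof. exact: is_linD (glinr z) x y. Qed.
Lemma gNl x z : g (- x) z = - g x z.
Proof. exact: is_linN (glinl z) x. Qed.
Lemma gNr x z : g z (- x) = - g z x.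
Proof. exact: is_linN (glinr z) x. Qed.
Lemma gZl a x z : g (a *: x) z = a * g x z.
Proof. exact: is_linZ (glinl z) a x. Qed.
Lemma gZr a x z : g z (a *: x) = a * g z x.
Proof. exact: is_linZ (glinr z) a x. Qed.
Lemma g0l z : g 0 z = 0.
Proof. exact: is_lin0 (glinl z). Qed.
Lemma g0r z : g z 0 = 0.
Proof. exact: is_lin0 (glinr z). Qed.

Definition metric_lin := (gDl, gDr, gNl, gNr, gZl, gZr, g0l, g0r).

Lemma adjointE f x y : g (adjoint g f x) y = g x (f y).
Proof.
rewrite /adjoint (form_opP gbform gnondeg)//; split=> z.
  by move=> a u v; rewrite is_lin_lfun; exact: glinr.
exact: glinl.
Qed.

Lemma adjointEr f x y : g x (adjoint g f y) = g (f x) y.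
Proof. by rewrite metricC adjointE metricC. Qed.

Lemma adjoint_is_lin : is_lin (adjoint g).
Proof.
move=> a f h; apply/lfunP => x; apply: (nondeg_inj gbform gnondeg) => y.
by rewrite add_lfunE scale_lfunE !metric_lin !adjointE add_lfunE scale_lfunE !metric_lin.
Qed.

Lemma adjointK f : adjoint g (adjoint g f) = f.
Proof.
apply/lfunP => x; apply: (nondeg_inj gbform gnondeg) => y.
by rewrite adjointE adjointEr.
Qed.

(* With [G] the Gram matrix and [M] the matrix of [f], skewness reads
   [M G = - G M^T]; hence [M = - G M^T G^-1] and [\tr M = - \tr M]. *)
Lemma lftrace_skew (f : 'End(W)) :
  (forall x y, g (f x) y = - g x (f y)) -> lftrace f = 0.
Proof.
move=> skew; pose n := \dim {:W}.
pose M := passmx.mxof (vbasis {:W}) (vbasis {:W}) f.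
pose G : 'M[R]_n := \matrix_(i, j) g (bvec i) (bvec j).
have fE i : f (bvec i) = \sum_k M i k *: bvec k.
  rewrite [LHS]bcoordP; apply: eq_bigr => k _; congr (_ *: _).
  by rewrite /M /passmx.mxof mxE mxE /= passmx.vecof_delta.
have MG : M *m G = - (G *m M^T).
  apply/matrixP => i j; rewrite !mxE.
  transitivity (g (f (bvec i)) (bvec j)).
    rewrite fE (is_lin_sum (glinl (bvec j))); apply: eq_bigr => k _.
    by rewrite gZl !mxE.
  rewrite skew; congr (- _); rewrite fE (is_lin_sum (glinr (bvec i))).
  by apply: eq_bigr => k _; rewrite gZr !mxE mulrC.
have Gu : G \in unitmx.
  (* A row [u] with [u G = 0] holds the coordinates of a vector [x] orthogonal to the whole basis;
     so [x = 0], and [u = 0] as the basis is free. *)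
  rewrite -row_free_unit -kermx_eq0; apply/eqP/row_matrixP => i.
  rewrite row0; set u := row i _.
  have uG : u *m G = 0 by rewrite /u -row_mul mulmx_ker row0.
  pose x := \sum_k u 0 k *: bvec k.
  have x0 : x = 0.
    apply: gnondeg => y; rewrite (bcoordP y) (is_lin_sum (glinr x)) big1// => j _.
    rewrite -[LHS]/(g _ _) gZr; suff -> : g x (bvec j) = 0 by rewrite mulr0.
    move/matrixP: uG => /(_ 0 j); rewrite !mxE => <-.
    rewrite (is_lin_sum (glinl (bvec j))); apply: eq_bigr => k _.
    by rewrite -[LHS]/(g _ _) gZl !mxE.
  have /freeP fr := basis_free (vbasisP {:W}).
  by apply/rowP => k; rewrite (fr (fun k => u 0 k) x0) mxE.
have /(congr1 mxtrace) : M = - (G *m M^T *m invmx G).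
  by rewrite -mulNmx -MG -mulmxA mulmxV// mulmx1.
rewrite raddfN /= mxtrace_mulC mulmxA mulVmx// mul1mx mxtrace_tr => h.
by rewrite /lftrace -/M; lra.
Qed.

End Metric.

End InnerProduct.

(** * Computing with curves modulo functions dominated by [n] *)

Section Congruence.
Variables (R : realType) (a b : R) (n : R -> R).
Implicit Types U V W : vectType R.

Local Notation D s := (a <= s <= b).

Definition bounded_fun (f : R -> R) : Prop :=
  exists C, forall s, D s -> `|f s| <= C.

Definition small_fun (f : R -> R) : Prop :=
  exists C, forall s, D s -> `|f s| <= C * n s.

Lemma bounded_funD f g :
  bounded_fun f -> bounded_fun g -> bounded_fun (fun s => f s + g s).
Proof.
move=> [C hC] [C' hC']; exists (C + C') => s Ds.
by rewrite (le_trans (ler_normD _ _))// lerD ?hC ?hC'.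
Qed.

Lemma bounded_funM f g :
  bounded_fun f -> bounded_fun g -> bounded_fun (fun s => f s * g s).
Proof.
move=> [C hC] [C' hC']; exists (C * C') => s Ds.
by rewrite normrM ler_pM ?hC ?hC'.
Qed.

Lemma small_funD f g :
  small_fun f -> small_fun g -> small_fun (fun s => f s + g s).
Proof.
move=> [C hC] [C' hC']; exists (C + C') => s Ds.
by rewrite (le_trans (ler_normD _ _))// mulrDl lerD ?hC ?hC'.
Qed.

Lemma small_funM f g :
  bounded_fun f -> small_fun g -> small_fun (fun s => f s * g s).
Proof.
move=> [C hC] [C' hC']; exists (C * C') => s Ds.
by rewrite normrM -mulrA ler_pM ?hC ?hC'.
Qed.

Lemma bounded_fun0 : bounded_fun (fun=> 0).
Proof. by exists 0 => s _; rewrite normr0. Qed.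

Lemma small_fun0 : small_fun (fun=> 0).
Proof. by exists 0 => s _; rewrite normr0 mul0r. Qed.

Lemma bounded_fun_sum (I : Type) (r : seq I) (f : I -> R -> R) :
  (forall i, bounded_fun (f i)) -> bounded_fun (fun s => \sum_(i <- r) f i s).
Proof.
move=> h; elim: r => [|i r IH].
  by under eq_fun do rewrite big_nil; exact: bounded_fun0.
by under eq_fun do rewrite big_cons; exact: bounded_funD.
Qed.

Lemma small_fun_sum (I : Type) (r : seq I) (f : I -> R -> R) :
  (forall i, small_fun (f i)) -> small_fun (fun s => \sum_(i <- r) f i s).
Proof.
move=> h; elim: r => [|i r IH].
  by under eq_fun do rewrite big_nil; exact: small_fun0.
by under eq_fun do rewrite big_cons; exact: small_funD.
Qed.

(* [u] and [v] are bounded on [a, b] and [u - v = O(n)] there. With [n] the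
   size of a curve that is to be shown to vanish, this is computation modulo
   the module of functions dominated by [n]. *)
Definition cong U (u v : R -> U) : Prop :=
  forall f : 'Hom(U, R^o),
    [/\ bounded_fun (fun s => f (u s)), bounded_fun (fun s => f (v s))
      & small_fun (fun s => f (u s) - f (v s))].

Lemma cong_ext U (u v u1 v1 : R -> U) :
  (forall s, D s -> u s = u1 s) -> (forall s, D s -> v s = v1 s) ->
  cong u v -> cong u1 v1.
Proof.
move=> hu hv h f; have [[C hC] [C' hC'] [C'' hC'']] := h f; split.
- by exists C => s Ds; rewrite -hu// hC.
- by exists C' => s Ds; rewrite -hv// hC'.
- by exists C'' => s Ds; rewrite -hu// -hv// hC''.
Qed.

Lemma cong_form U (u v : R -> U) (f : U -> R) : is_lin (f : U -> R^o) ->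
  cong u v -> [/\ bounded_fun (fun s => f (u s)), bounded_fun (fun s => f (v s))
    & small_fun (fun s => f (u s) - f (v s))].
Proof.
move=> lf /(_ (linfun (f : U -> R^o))).
have E (w : R -> U) : (fun s => linfun (f : U -> R^o) (w s)) = (fun s => f (w s)).
  by apply/funext => s; rewrite (lfun_linE lf).
rewrite !E; case=> h1 h2 [C hC]; split=> //; exists C => s /hC.
by rewrite !(lfun_linE lf).
Qed.

Lemma cong_sym U (u v : R -> U) : cong u v -> cong v u.
Proof.
move=> h f; have [h1 h2 [C hC]] := h f; split=> //.
by exists C => s Ds; rewrite distrC hC.
Qed.

Lemma cong_trans U (u v w : R -> U) : cong u v -> cong v w -> cong u w.
Proof.
move=> h h' f; have [h1 h2 h3] := h f; have [h4 h5 h6] := h' f; split=> //.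
have := small_funD h3 h6; congr small_fun; apply/funext => s; lra.
Qed.

Lemma cong_reflr U (u v : R -> U) : cong u v -> cong v v.
Proof. by move=> h; exact: cong_trans (cong_sym h) h. Qed.

Lemma cong_cst U (w : U) : cong (fun=> w) (fun=> w).
Proof.
move=> f; have h : bounded_fun (fun=> f w) by exists `|f w|.
by split=> //; under eq_fun do rewrite subrr; exact: small_fun0.
Qed.

Lemma cong_add U (u v u' v' : R -> U) : cong u v -> cong u' v' ->
  cong (fun s => u s + u' s) (fun s => v s + v' s).
Proof.
move=> h h' f; have [h1 h2 h3] := h f; have [h4 h5 h6] := h' f.
split; do ?under eq_fun do rewrite !linearD /=; do ?exact: bounded_funD.
have := small_funD h3 h6; congr small_fun; apply/funext => s; lra.
Qed.

Lemma cong_app U V (A A' : R -> U -> V) (u u' : R -> U) :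
  (forall s, is_lin (A s)) -> (forall s, is_lin (A' s)) ->
  (forall x, cong (A^~ x) (A'^~ x)) -> cong u u' ->
  cong (fun s => A s (u s)) (fun s => A' s (u' s)).
Proof.
move=> lA lA' hA hu f.
have E (B : R -> U -> V) (w : R -> U) : (forall s, is_lin (B s)) ->
    (fun s => f (B s (w s))) = (fun s => \sum_i bcoord i (w s) * f (B s (bvec i))).
  move=> lB; apply/funext => s; rewrite (lin_expand (w s) (lB s)) linear_sum.
  by apply: eq_bigr => i _; rewrite linearZ.
have EA := E A u lA; have EA' := E A' u' lA'.
have hi i := cong_form (@is_lin_coord R U i) hu.
split.
- rewrite EA; apply: bounded_fun_sum => i; apply: bounded_funM.
    by case: (hi i).
  by case: (hA (bvec i) f).
- rewrite EA'; apply: bounded_fun_sum => i; apply: bounded_funM.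
    by case: (hi i).
  by case: (hA (bvec i) f).
- rewrite (_ : (fun s => _) = (fun s => \sum_i (bcoord i (u s) * f (A s (bvec i)) -
      bcoord i (u' s) * f (A' s (bvec i))))); last first.
    apply/funext => s; rewrite sumrB.
    by have /(congr1 (@^~ s)) /= -> := EA; have /(congr1 (@^~ s)) /= -> := EA'.
  apply: small_fun_sum => i.
  have [_ bu' su] := hi i; have [bA _ sA] := hA (bvec i) f.
  (* The splitting [u A - u' A' = A (u - u') + u' (A - A')]: each summand is bounded times small,
     which is why [cong] also records boundedness. *)
  have := small_funD (small_funM bA su) (small_funM bu' sA).
  by congr small_fun; apply/funext => s; ring.
Qed.

Lemma cong_lin U V (h : U -> V) (u v : R -> U) :
  is_lin h -> cong u v -> cong (fun s => h (u s)) (fun s => h (v s)).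
Proof.
move=> lh huv; apply: (@cong_app U V (fun=> h) (fun=> h)) => // x.
exact: cong_cst.
Qed.

Lemma cong_opp U (u v : R -> U) :
  cong u v -> cong (fun s => - u s) (fun s => - v s).
Proof. by apply: cong_lin; apply: is_lin_opp; exact: is_lin_id. Qed.

Lemma cong_sub U (u v u' v' : R -> U) : cong u v -> cong u' v' ->
  cong (fun s => u s - u' s) (fun s => v s - v' s).
Proof. by move=> h h'; apply: cong_add => //; exact: cong_opp. Qed.

Lemma cong_scale U c (u v : R -> U) :
  cong u v -> cong (fun s => c *: u s) (fun s => c *: v s).
Proof. by apply: cong_lin; apply: is_lin_scale; exact: is_lin_id. Qed.

Lemma cong_sum U (I : Type) (r : seq I) (u v : I -> R -> U) :
  (forall i, cong (u i) (v i)) ->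
  cong (fun s => \sum_(i <- r) u i s) (fun s => \sum_(i <- r) v i s).
Proof.
move=> h; elim: r => [|i r IH].
  by apply: (cong_ext _ _ (cong_cst 0)) => s _; rewrite big_nil.
by apply: (cong_ext _ _ (cong_add (h i) IH)) => s _; rewrite big_cons.
Qed.

(** A finite sum in which each term depends linearly on one value of [A]. It reduces congruence and
    differentiability of curves of linear maps to their pointwise versions. *)
Lemma lfun_rank1_sum U V (A : 'Hom(U, V)) :
  A = \sum_i linfun (fun x => bcoord i x *: A (bvec i)).
Proof.
apply/lfunP => x; rewrite sum_lfunE (lin_expand x (is_lin_lfun A)).
apply: eq_bigr => i _; rewrite lfun_linE// => c y z.
by rewrite is_lin_coord scalerDl scalerA.
Qed.

Lemma is_lin_rank1 U V i : is_lin (fun v : V => linfun (fun x : U => bcoord i x *: v)).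
Proof.
apply: is_lin_hom => [v|x] c y z; last by rewrite scalerDr !scalerA mulrC.
by rewrite is_lin_coord scalerDl scalerA.
Qed.

Lemma cong_hom U V (A A' : R -> 'Hom(U, V)) :
  (forall x, cong (fun s => A s x) (fun s => A' s x)) -> cong A A'.
Proof.
move=> h; apply: (cong_ext (fun s _ => esym (lfun_rank1_sum (A s)))
  (fun s _ => esym (lfun_rank1_sum (A' s)))).
apply: cong_sum => i.
apply: (@cong_lin _ _ (fun v : V => linfun (fun x : U => bcoord i x *: v)) _ _ _ (h _)).
exact: is_lin_rank1.
Qed.

Lemma cong_homE U V (A A' : R -> 'Hom(U, V)) x :
  cong A A' -> cong (fun s => A s x) (fun s => A' s x).
Proof.
apply: (@cong_lin _ _ (fun B : 'Hom(U, V) => B x)).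
by apply: is_lin_app; exact: is_lin_id.
Qed.

Lemma cong_happ U V (A A' : R -> 'Hom(U, V)) u u' :
  cong A A' -> cong u u' -> cong (fun s => A s (u s)) (fun s => A' s (u' s)).
Proof.
move=> hA hu; apply: (@cong_app U V (fun s => A s) (fun s => A' s)) => //.
- by move=> s; exact: is_lin_lfun.
- by move=> s; exact: is_lin_lfun.
- by move=> x; exact: cong_homE.
Qed.

Lemma cong_trace W (A A' : R -> 'End(W)) : cong A A' ->
  cong (fun s => lftrace (A s) : R^o) (fun s => lftrace (A' s) : R^o).
Proof. by apply: cong_lin; exact: lftrace_is_lin. Qed.

(** Every linear form is a pairing with a fixed vector. Operators obtained from [form_op] can
    therefore be handled through their defining identities. *)
Lemma cong_rep W (g : W -> W -> R) (u v : R -> W) : inner_product g ->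
  (forall y, cong (fun s => g (u s) y : R^o) (fun s => g (v s) y : R^o)) ->
  cong u v.
Proof.
move=> ig h f.
have [x xE] := form_rep (gbform ig) (gnondeg ig) (is_lin_lfun f).
have := h x (linfun (fun x : R^o => x)).
have fE w : f w = linfun (fun x : R^o => x) (g w x).
  by rewrite lfun_linE ?(metricC ig w x) ?xE//; exact: is_lin_id.
by case=> h1 h2 h3; split; do ?under eq_fun do rewrite !fE.
Qed.

Lemma cong_eq U (u v : R -> U) s : D s -> n s = 0 -> cong u v -> u s = v s.
Proof.
move=> Ds ns h; apply: form_ext => f; have [_ _ [C /(_ s Ds)]] := h f.
by rewrite ns mulr0 normr_le0 subr_eq0 => /eqP.
Qed.

End Congruence.

(** * Derivatives of curves, and the Gronwall argument *)

Section CurveDerivatives.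
Variable R : realType.
Implicit Types U V W : vectType R.

Lemma vderive_form U t (u : R -> U) w (f : U -> R) : is_lin (f : U -> R^o) ->
  is_vderive t u w -> is_derive t (1 : R) (fun s => f (u s)) (f w).
Proof.
move=> lf /(_ (linfun (f : U -> R^o))).
rewrite (_ : (fun s => _) = (fun s => f (u s))).
  by rewrite (lfun_linE lf).
by apply/funext => s; rewrite (lfun_linE lf).
Qed.

Lemma vderive_lin U V (h : U -> V) t (u : R -> U) w :
  is_lin h -> is_vderive t u w -> is_vderive t (fun s => h (u s)) (h w).
Proof.
move=> lh hu f; apply: (vderive_form (f := fun x => f (h x))) hu.
by move=> a x y; rewrite lh is_lin_lfun.
Qed.

Lemma vderive_add U t (u v : R -> U) u' v' : is_vderive t u u' ->
  is_vderive t v v' -> is_vderive t (fun s => u s + v s) (u' + v').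
Proof.
move=> hu hv f; under eq_fun do rewrite linearD; rewrite linearD.
exact: is_deriveD (hu f) (hv f).
Qed.

Lemma vderive_cst U t (w : U) : is_vderive t (fun=> w) 0.
Proof. by move=> f; rewrite linear0; exact: is_derive_cst. Qed.

Lemma vderive_sum U t (I : Type) (r : seq I) (u : I -> R -> U) (u' : I -> U) :
  (forall i, is_vderive t (u i) (u' i)) ->
  is_vderive t (fun s => \sum_(i <- r) u i s) (\sum_(i <- r) u' i).
Proof.
move=> h; elim: r => [|i r IH].
  by under eq_fun do rewrite big_nil; rewrite big_nil; exact: vderive_cst.
by under eq_fun do rewrite big_cons; rewrite big_cons; exact: vderive_add.
Qed.

Lemma vderive_app U V t (A : R -> U -> V) A' (u : R -> U) u' :
  (forall s, is_lin (A s)) -> is_lin A' ->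
  (forall x, is_vderive t (A^~ x) (A' x)) -> is_vderive t u u' ->
  is_vderive t (fun s => A s (u s)) (A' (u t) + A t u').
Proof.
move=> lA lA' hA hu f.
under eq_fun do rewrite (lin_expand (u _) (lA _)) linear_sum.
rewrite (lin_expand (u t) lA') (lin_expand u' (lA t)) -big_split linear_sum /=.
set F := fun i (s : R) => f (bcoord i (u s) *: A s (bvec i)).
have -> : (fun s => \sum_i f (bcoord i (u s) *: A s (bvec i))) = \sum_i F i.
  by apply/funext => s; rewrite fct_sumE.
apply: is_derive_sum => i; rewrite /F; under eq_fun do rewrite linearZ.
have h1 := hA (bvec i) f.
have h2 := vderive_form (@is_lin_coord R U i) hu.
apply: is_derive_eq (is_deriveM h2 h1) _.
by rewrite linearD !linearZ /=; congr (_ + _); exact: mulrC.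
Qed.

Lemma vderive_hom U V t (A : R -> 'Hom(U, V)) (A' : 'Hom(U, V)) :
  (forall x, is_vderive t (fun s => A s x) (A' x)) -> is_vderive t A A'.
Proof.
move=> h; rewrite (lfun_rank1_sum A').
rewrite (_ : A = fun s => \sum_i linfun (fun x => bcoord i x *: A s (bvec i))).
  apply: vderive_sum => i.
  apply: (@vderive_lin _ _ (fun v : V => linfun (fun x : U => bcoord i x *: v)) _ _ _ _ (h _)).
  exact: is_lin_rank1.
by apply/funext => s; exact: lfun_rank1_sum.
Qed.

Lemma vderive_homE U V t (A : R -> 'Hom(U, V)) (A' : 'Hom(U, V)) x :
  is_vderive t A A' -> is_vderive t (fun s => A s x) (A' x).
Proof.
by move=> h; apply: (vderive_lin (h := fun A : 'Hom(U, V) => A x)) h;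
  apply: is_lin_app; exact: is_lin_id.
Qed.

Lemma vderive_happ U V t (A : R -> 'Hom(U, V)) (A' : 'Hom(U, V)) (u : R -> U) u' :
  is_vderive t A A' -> is_vderive t u u' ->
  is_vderive t (fun s => A s (u s)) (A' (u t) + A t u').
Proof.
move=> hA hu; apply: (@vderive_app U V t (fun s => A s)) => //.
- by move=> s; exact: is_lin_lfun.
- exact: is_lin_lfun.
- by move=> x; exact: vderive_homE.
Qed.

(** Reflexivity of [cong] amounts to boundedness, which the extreme value theorem supplies for a
    differentiable, hence continuous, curve. *)
Lemma cong_vderive U (u u' : R -> U) a b n :
  (forall t, a <= t <= b -> is_vderive t u (u' t)) -> cong a b n u u.
Proof.
move=> h f; suff bf : bounded_fun a b (fun s => f (u s)).
  by split=> //; under eq_fun do rewrite subrr; exact: small_fun0.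
have [ab|ba] := leP a b; last first.
  by exists 0 => s /andP[as_ sb]; have := lt_le_trans ba (le_trans as_ sb);
    rewrite ltxx.
have cf : {within `[a, b], continuous (fun s => f (u s) : R)}.
  apply: derivable_within_continuous => x; rewrite in_itv /= => xab.
  by have [] := h x xab f.
have [M _ hM] := EVT_max ab cf; have [m _ hm] := EVT_min ab cf.
exists (`|f (u M)| + `|f (u m)|) => s Ds.
have := hM s; have := hm s; rewrite in_itv /= Ds => /(_ isT) h1 /(_ isT) h2.
have := ler_norm (f (u M)); have := ler_norm (- f (u m)); rewrite normrN.
have := normr_ge0 (f (u M)); have := normr_ge0 (f (u m)).
by move=> *; rewrite ler_norml; apply/andP; split; lra.
Qed.

(** The integrating factor [expR (- C * s)] makes the derivative of [h] nonpositive. The mean value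
    theorem then gives [h b <= 0], while [f b >= 0]. *)
Lemma gronwall_zero (f df : R -> R) (C b : R) : 0 <= b -> f 0 = 0 ->
  (forall s, 0 <= s <= b -> 0 <= f s) ->
  (forall s, 0 <= s <= b -> is_derive s (1 : R) f (df s)) ->
  (forall s, 0 <= s <= b -> df s <= C * f s) -> f b = 0.
Proof.
move=> b0 f0 fge0 hd hle.
pose h s := f s * expR (- C * s).
pose dh s := f s * (expR (- C * s) * - C) + expR (- C * s) * df s.
have hder s : 0 <= s <= b -> is_derive s (1 : R) h (dh s).
  move=> hs; have e1 : is_derive s (1 : R) (fun s => - C * s) (- C).
    apply: is_derive_eq (is_deriveZ _ (is_derive_id s 1)) _.
    by rewrite -[LHS]/(- C * 1) mulr1.
  have e2 := is_derive1_comp (is_derive_expR _) e1.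
  exact: is_derive_eq (is_deriveM (hd s hs) e2) _.
have [//|bn0] := eqVneq b 0; first by move=> ->.
have bgt0 : 0 < b by rewrite lt_neqAle eq_sym bn0.
have ch : {within `[0, b], continuous h}.
  apply: derivable_within_continuous => x; rewrite in_itv /= => xab.
  by have [] := hder x xab.
have [|c] := MVT bgt0 _ ch (df := dh).
  move=> x; rewrite in_itv /= => /andP[x0 xb]; apply: hder.
  by rewrite !ltW.
rewrite in_itv /= => /andP[c0 cb] E.
have dhc : dh c <= 0.
  rewrite (_ : dh c = expR (- C * c) * (df c - C * f c)); last by rewrite /dh; ring.
  by rewrite mulr_ge0_le0 ?expR_ge0// subr_le0 hle// !ltW.
have : h b <= 0.
  have h0 : h 0 = 0 by rewrite /h f0 mul0r.
  move: E; rewrite h0 !subr0 => ->.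
  by rewrite mulr_le0_ge0// ltW.
rewrite /h pmulr_lle0 ?expR_gt0// => fb0.
by apply/eqP; rewrite eq_le fb0 fge0// b0 lexx.
Qed.

(** The last hypothesis is [c' = O(c)]. It is stated for arbitrary [n] so that it can be discharged
    inside the calculus of [cong]; the proof takes for [n] the sum of the absolute coordinates of
    [c] and applies Gronwall to the sum of their squares. *)
Lemma vanish U (I : set R) (c c' : R -> U) :
  is_interval I -> I 0 -> c 0 = 0 ->
  (forall t, I t -> is_vderive t c (c' t)) ->
  (forall a b n, (forall s, a <= s <= b -> I s) ->
     cong a b n c (fun=> 0) -> cong a b n c' (fun=> 0)) ->
  forall t, I t -> c t = 0.
Proof.
move=> itvI I0 c0 hd hc t It.
pose a := Num.min 0 t; pose b := Num.max 0 t.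
have DI s : a <= s <= b -> I s.
  rewrite /a /b /Num.min /Num.max; case: ifP => _ /andP[h1 h2].
    by apply: (itvI 0 t) => //; rewrite h1.
  by apply: (itvI t 0) => //; rewrite h1.
pose x i s := bcoord i (c s); pose x' i s := bcoord i (c' s).
have xd i s : I s -> is_derive s (1 : R) (x i) (x' i s).
  by move=> /hd; apply: vderive_form; exact: is_lin_coord.
pose n s := \sum_i `|x i s|.
have c_small : cong a b n c (fun=> 0).
  have h : cong a b n c c by apply: cong_vderive => s /DI; exact: hd.
  move=> f; have [bf _ _] := h f; split=> //.
    by under eq_fun do rewrite linear0; exact: bounded_fun0.
  exists (\sum_i `|f (bvec i)|) => s Ds; rewrite linear0 subr0.
  rewrite (lin_expand (c s) (is_lin_lfun f)) (le_trans (ler_norm_sum _ _ _))//.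
  rewrite /n mulr_suml ler_sum// => i _.
  rewrite -[X in `|X|]/(bcoord i (c s) * f (bvec i)) normrM mulrC ler_wpM2l//.
  rewrite /x (bigD1 i)//= lerDl sumr_ge0//.
have {hc} c'_small := hc _ _ _ DI c_small.
have hC i : exists C, forall s, a <= s <= b -> `|x' i s| <= C * n s.
  have [_ _ [C hC]] := cong_form (@is_lin_coord R U i) c'_small.
  by exists C => s /hC; rewrite (is_lin0 (@is_lin_coord R U i)) subr0.
(* One constant is chosen per coordinate; the absolute value makes it nonnegative, as the estimate
   of [df] requires. *)
pose C i := `|xget 0 [set C | forall s, a <= s <= b -> `|x' i s| <= C * n s]|.
have nge0 s : 0 <= n s by rewrite sumr_ge0.
have {}hC i s : a <= s <= b -> `|x' i s| <= C i * n s.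
  move=> Ds; rewrite /C; case: xgetP => [K _ /= /(_ s Ds) h|none]; last first.
    by case: (hC i) => K hK; case: (none K).
  by rewrite (le_trans h)// ler_wpM2r// ler_norm.
pose f s := \sum_i x i s * x i s.
pose df s := \sum_i (x i s * x' i s + x i s * x' i s).
have fd s : I s -> is_derive s (1 : R) f (df s).
  move=> Is; rewrite /f (_ : (fun s => _) = \sum_i (x i * x i)); last first.
    by apply/funext => r; rewrite fct_sumE.
  by apply: is_derive_sum => i; apply: is_deriveM; exact: xd.
have xf i s : `|x i s| * `|x i s| <= f s.
  rewrite -normrM ger0_norm -?expr2 ?sqr_ge0// /f (bigD1 i)//= expr2 lerDl sumr_ge0//.
  by move=> j _; rewrite -expr2 sqr_ge0.
have xxf i j s : `|x i s| * `|x j s| <= f s.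
  have := xf i s; have := xf j s; have := sqr_ge0 (`|x i s| - `|x j s|).
  by rewrite expr2 => *; nra.
(* [|df|] is at most the sum over [i] and [j] of [2 * C i * |x i| * |x j|], and
   [|x i| * |x j| <= f]. *)
pose K := \sum_(i < \dim {:U}) \sum_(j < \dim {:U}) (C i + C i).
have dfK s : a <= s <= b -> `|df s| <= K * f s.
  move=> Ds; rewrite (le_trans (ler_norm_sum _ _ _))// /K mulr_suml ler_sum// => i _.
  rewrite -mulr2n normrMn normrM.
  have h := ler_wpM2l (normr_ge0 (x i s)) (hC i s Ds).
  apply: (@le_trans _ _ ((`|x i s| * (C i * n s)) *+ 2)); first by rewrite lerMn2r h orbT.
  rewrite /n mulr_sumr mulr_sumr -sumrMnl mulr_suml ler_sum// => j _.
  have C0 : 0 <= C i by rewrite /C.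
  by have := ler_wpM2l C0 (xxf i j s); rewrite mulr2n; lra.
have fge0 s : 0 <= f s by rewrite sumr_ge0// => i _; rewrite -expr2 sqr_ge0.
have f0 : f 0 = 0.
  rewrite /f big1// => i _; rewrite /x c0.
  by have := is_lin0 (@is_lin_coord R U i) => ->; rewrite mul0r.
have ft : f t = 0.
  have [t0|t0] := leP 0 t.
    apply: (@gronwall_zero f df K t) => // s Ds.
      by apply/fd/DI; rewrite /a /b (min_idPl t0) (max_idPr t0).
    rewrite (le_trans (ler_norm _))// dfK// /a /b.
    by rewrite (min_idPl t0) (max_idPr t0).
  have E s : 0 <= s <= - t -> a <= - s <= b.
    by rewrite /a /b (min_idPr (ltW t0)) (max_idPl (ltW t0)) lerNr oppr_le0 andbC.
  (* For negative [t], time is reversed. *)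
  have := @gronwall_zero (fun s => f (- s)) (fun s => - df (- s)) K (- t).
  rewrite opprK oppr0 oppr_ge0 => hgron; apply: hgron => //; first exact: ltW.
    move=> s Ds; rewrite -[- df _]mulrN1.
    apply: (is_derive1_comp (f := f) (g := -%R)).
    by apply/fd/DI/E.
  by move=> s Ds; rewrite (le_trans (ler_norm _))// normrN dfK// E.
apply: form_ext => h; rewrite (lin_expand (c t) (is_lin_lfun h)) linear0 big1// => i _.
suff -> : bcoord i (c t) = 0 by rewrite scale0r.
have := xf i t; rewrite ft -normrM normr_le0 mulf_eq0 orbb => /eqP.
exact.
Qed.

End CurveDerivatives.

Lemma scalar_ext (R : realType) (W : vectType R) (x y : W) :
  (forall f : {scalar W}, f x = f y) -> x = y.
Proof.
move=> h; rewrite (bcoordP x) (bcoordP y); apply: eq_bigr => i _; congr (_ *: _).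
exact: (h (coord (vbasis {:W}) i)).
Qed.

Section Rewriting.
Variables (R : realType) (U V : vectType R).
Implicit Types (A : 'Hom(U, V)) (f : {scalar U}).

Lemma lfunD A x y : A (x + y) = A x + A y. Proof. exact: linearD. Qed.
Lemma lfunN A x : A (- x) = - A x. Proof. exact: linearN. Qed.
Lemma lfunZ A a x : A (a *: x) = a *: A x. Proof. exact: linearZ. Qed.
Lemma lfun0 A : A 0 = 0. Proof. exact: linear0. Qed.

Lemma scalarD f x y : f (x + y) = f x + f y. Proof. exact: linearD. Qed.
Lemma scalarN f x : f (- x) = - f x. Proof. exact: linearN. Qed.
Lemma scalarZ f a x : f (a *: x) = a * f x. Proof. exact: linearZ. Qed.
Lemma scalar0 f : f 0 = 0. Proof. exact: linear0. Qed.

End Rewriting.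

Definition lfun_simp := (add_lfunE, opp_lfunE, scale_lfunE, comp_lfunE, zero_lfunE).
Definition lfun_lin := (lfunD, lfunN, lfunZ, lfun0).
Definition scalar_lin (R : realType) (U : vectType R) (f : {scalar U}) :=
  (scalarD f, scalarN f, scalarZ f, scalar0 f).

(** Testing a vector identity against a generic linear form turns it into an identity of real
    numbers, which [ring] decides. *)
Ltac vring :=
  let f := fresh "f" in
  apply: scalar_ext => f; rewrite ?(lfun_lin, lfun_simp) ?(scalar_lin f); ring.

(** * Levi-Civita connection, curvature and Ricci tensor of a bilinear product *)

Section Geometry.
Variables (R : realType) (W : vectType R) (g : W -> W -> R).
Hypothesis ig : inner_product g.
Local Notation M := 'Hom(W, 'End(W)).
Implicit Types mu nu : M.

Lemma bracket_is_linl mu y : is_lin (fun x => mu x y).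
Proof. by apply: is_lin_app; exact: is_lin_lfun. Qed.

Lemma bracket_is_linr mu x : is_lin (fun y => mu x y).
Proof. exact: is_lin_lfun. Qed.

Let koszul mu x y z : R := 2^-1 * (g (mu x y) z - g (mu y z) x + g (mu z x) y).

Let koszul_bform mu x : bform (koszul mu x).
Proof.
split=> [y|z] a u v; rewrite /koszul !(is_lin_lfun, bracket_is_linl, metric_lin ig).
  rewrite -[RHS]/(_ + _ : R) -[X in _ = X + _]/(_ * _ : R); ring.
rewrite -[RHS]/(_ + _ : R) -[X in _ = X + _]/(_ * _ : R); ring.
Qed.

Lemma nablaE mu x y z : g (nabla g mu x y) z =
  2^-1 * (g (mu x y) z - g (mu y z) x + g (mu z x) y).
Proof. exact: (form_opP (gbform ig) (gnondeg ig) _ _ (koszul_bform mu x)). Qed.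

Lemma metric_ext x y : (forall z, g x z = g y z) -> x = y.
Proof. by move=> h; apply: (nondeg_inj (gbform ig) (gnondeg ig)) => z; exact: h. Qed.

Lemma nabla_is_lin mu : is_lin (nabla g mu).
Proof.
move=> a x x'; apply/lfunP => y; apply: metric_ext => z.
rewrite !lfun_simp !(metric_lin ig) !nablaE !(is_lin_lfun, bracket_is_linl, metric_lin ig).
ring.
Qed.

Lemma nabla_is_lin_app mu y : is_lin (fun x => nabla g mu x y).
Proof. by apply: is_lin_app; exact: nabla_is_lin. Qed.

Lemma curvatureE mu x y z : curvature g mu x y z =
  nabla g mu x (nabla g mu y z) - nabla g mu y (nabla g mu x z)
  - nabla g mu (mu x y) z.
Proof. by rewrite /curvature !lfun_simp. Qed.

Lemma curvature_is_lin1 mu y z : is_lin (fun x => curvature g mu x y z).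
Proof.
move=> a x x'; rewrite !curvatureE.
rewrite !(bracket_is_linl, nabla_is_lin_app, is_lin_lfun (nabla g mu y)); vring.
Qed.

Lemma curvature_is_lin2 mu x z : is_lin (fun y => curvature g mu x y z).
Proof.
move=> a y y'; rewrite !curvatureE.
by rewrite !(bracket_is_linr, nabla_is_lin_app, is_lin_lfun (nabla g mu x)); vring.
Qed.

Lemma ricci_tensor_bform mu : bform (ricci_tensor g mu).
Proof.
have lc y z := lfun_linE (curvature_is_lin1 mu y z).
split=> [y|z] a u v; rewrite /ricci_tensor -[RHS]lftrace_is_lin; congr lftrace;
  apply/lfunP => x; rewrite !lfun_simp !lc.
  exact: is_lin_lfun.
exact: curvature_is_lin2.
Qed.

Lemma ricci_opE mu y z : g (ricci_op g mu y) z = ricci_tensor g mu y z.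
Proof. exact: (form_opP (gbform ig) (gnondeg ig) _ _ (ricci_tensor_bform mu)). Qed.

Lemma alternating_anti mu : (forall u, mu u u = 0) ->
  forall u v, mu u v = - mu v u.
Proof.
move=> alt u v; apply/eqP; rewrite -addr_eq0; have := alt (u + v).
by rewrite !lfunD !add_lfunE !alt add0r addr0 addrC => ->.
Qed.

(** For an alternating bracket, Koszul's expression is antisymmetric in [y] and [z]. *)
Lemma nabla_skew mu x y z : (forall u, mu u u = 0) ->
  g (nabla g mu x y) z = - g y (nabla g mu x z).
Proof.
move=> alt; have anti := alternating_anti alt.
rewrite (metricC ig y) !nablaE (anti x y) (anti z x) (anti z y) !(metric_lin ig); ring.
Qed.

Lemma nabla_torsion mu x y : (forall u, mu u u = 0) ->
  nabla g mu x y - nabla g mu y x = mu x y.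
Proof.
move=> alt; have anti := alternating_anti alt.
apply: metric_ext => z; rewrite !(metric_lin ig) !nablaE.
rewrite (anti y x) (anti z x) (anti z y) !(metric_lin ig); lra.
Qed.

Definition jac mu x y z : W := mu x (mu y z) + mu y (mu z x) + mu z (mu x y).

(** Vanishing torsion expresses the brackets in [jac] through [nabla]; the resulting terms regroup
    into the cyclic sum of the curvature. *)
Lemma bianchi mu x y z : (forall u, mu u u = 0) ->
  curvature g mu x y z + curvature g mu y z x + curvature g mu z x y
  = jac mu x y z.
Proof.
move=> alt; have T u v := @nabla_torsion mu u v alt.
rewrite /jac -(T x) -(T y (mu z x)) -(T z (mu x y)).
have D u v w : nabla g mu u (mu v w) =
    nabla g mu u (nabla g mu v w) - nabla g mu u (nabla g mu w v).
  by rewrite -[in LHS](T v w) linearB.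
rewrite !curvatureE !D; vring.
Qed.

Lemma curvature_traceless mu x y : (forall u, mu u u = 0) ->
  lftrace (curvature g mu x y) = 0.
Proof.
move=> alt; rewrite /curvature.
have skew w : lftrace (nabla g mu w) = 0.
  by apply: (lftrace_skew ig) => u v; exact: nabla_skew.
have := is_linB (@lftrace_is_lin R W); rewrite /= => B.
by rewrite !B skew lftraceC subrr subr0.
Qed.

(* The Ricci tensor of a bilinear alternating product that is not a Lie bracket
   need not be symmetric: the first Bianchi identity has the Jacobiator on the
   right-hand side. *)
Lemma ricci_tensor_anti mu y z : (forall u, mu u u = 0) ->
  ricci_tensor g mu y z - ricci_tensor g mu z y
  = lftrace (linfun (fun x => jac mu x y z)).
Proof.
move=> alt; have anti := alternating_anti alt.
have := is_linB (@lftrace_is_lin R W); rewrite /= => B.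
have := is_linD (@lftrace_is_lin R W); rewrite /= => D.
(* The added zero is the trace of [curvature y z], the third term of the cyclic sum in [bianchi]. *)
rewrite -[LHS]addr0 -(@curvature_traceless mu y z)// /ricci_tensor.
rewrite -[LHS]/(_ - _ + _ : R^o) -B -D; congr lftrace; apply/lfunP => x.
have lj : is_lin (fun x => jac mu x y z).
  by move=> a u v; rewrite /jac !(is_lin_lfun, bracket_is_linl); vring.
rewrite !lfun_simp (lfun_linE (curvature_is_lin1 mu y z)).
rewrite (lfun_linE (curvature_is_lin1 mu z y)) (lfun_linE lj).
rewrite -(bianchi x y z alt).
have -> : curvature g mu x z y = - curvature g mu z x y.
  by rewrite !curvatureE (anti x z) (is_linN (nabla_is_lin_app mu y)); vring.
vring.
Qed.

End Geometry.

(** * Chern-Ricci operator, flow field and Jacobiator *)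

Section AlmostHermitian.
Variables (R : realType) (W : vectType R) (g : W -> W -> R) (J : 'End(W)).
Hypotheses (ig : inner_product g) (JJ : forall x, J (J x) = - x).
Hypothesis gJ : forall x y, g (J x) (J y) = g x y.
Local Notation M := 'Hom(W, 'End(W)).
Local Notation omega := (fundamental_form g J).
Implicit Types mu nu : M.

Lemma omega_bform : bform omega.
Proof.
split=> [x|y] a u v; rewrite /fundamental_form ?(is_lin_lfun J).
  exact: glinr.
exact: glinl.
Qed.

Lemma omega_nondeg : nondegenerate omega.
Proof.
move=> x h; have : J x = 0 by apply: (gnondeg ig) => y; exact: h.
by move=> /(congr1 J); rewrite JJ linear0 => /eqP; rewrite oppr_eq0 => /eqP.
Qed.

Lemma gJl x y : g (J x) y = - g x (J y).
Proof. by rewrite -gJ JJ (gNl ig). Qed.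

Lemma omega_anti x y : omega x y = - omega y x.
Proof. by rewrite /fundamental_form gJl (metricC ig). Qed.

(* The Chern-Ricci form is [1/2 * ricci_potential [x, y]]. *)
Definition ricci_potential mu (u : W) : R :=
  lftrace (mu (J u)) - lftrace (J \o mu u)%VF.

Lemma ricci_potential_is_lin mu : is_lin (ricci_potential mu : W -> R^o).
Proof.
apply: is_lin_sub => a x y.
  by rewrite !(is_lin_lfun J, is_lin_lfun mu); exact: lftrace_is_lin.
by rewrite (is_lin_lfun mu) comp_lfunDr -comp_lfunZr; exact: lftrace_is_lin.
Qed.

Lemma chern_ricci_formE mu x y :
  chern_ricci_form J mu x y = 2^-1 * ricci_potential mu (mu x y).
Proof. by rewrite /chern_ricci_form /ricci_potential; ring. Qed.

Lemma chern_ricci_form_bform mu : bform (chern_ricci_form J mu).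
Proof.
split=> [x|y] a u v; rewrite !chern_ricci_formE ?lfunD ?lfunZ ?lfun_simp;
  rewrite ricci_potential_is_lin mulrDr mulrCA; congr (_ + _).
Qed.

Lemma chern_ricci_opE mu x y :
  omega (chern_ricci_op g J mu x) y = chern_ricci_form J mu x y.
Proof. exact: (form_opP omega_bform omega_nondeg _ _ (chern_ricci_form_bform mu)). Qed.

Lemma g_chern_ricci_op mu x y :
  g (chern_ricci_op g J mu x) y = chern_ricci_form J mu x (J y).
Proof. by rewrite -chern_ricci_opE /fundamental_form gJ. Qed.

Lemma ricci_acE mu x y : g (ricci_ac g J mu x) y =
  2^-1 * (ricci_tensor g mu x y - ricci_tensor g mu (J x) (J y)).
Proof.
rewrite /ricci_ac !lfun_simp (gZl ig) (gDl ig) (gJl (ricci_op _ _ _)).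
by rewrite !(ricci_opE ig).
Qed.

Definition flow_op mu : 'End(W) := chern_ricci_op g J mu + ricci_ac g J mu.

Lemma delta_bilin mu E : bilin (delta mu E).
Proof.
by split=> [x|y] a u v; rewrite /delta; vring.
Qed.

Definition flow_field mu : M := bilin_lfun (delta mu (flow_op mu)).

Lemma flow_fieldE mu x y : flow_field mu x y = delta mu (flow_op mu) x y.
Proof. exact/bilin_lfunE/delta_bilin. Qed.

Lemma bracket_flowP (I : set R) (mu : R -> M) : bracket_flow g J I mu <->
  forall t, I t -> is_vderive t mu (flow_field (mu t)).
Proof.
split=> h t It.
  apply: vderive_hom => x; apply: vderive_hom => y; rewrite flow_fieldE.
  exact: h.
move=> x y; rewrite -flow_fieldE.
by apply: vderive_homE; apply: vderive_homE; exact: h.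
Qed.

(** Packed as an element of a vector space, so that it can be the curve in [vanish]. *)
Definition jacobiator mu : 'Hom(W, 'Hom(W, 'End(W))) :=
  linfun (fun x => bilin_lfun (jac mu x)).

Lemma jacobiatorE mu x y z : jacobiator mu x y z = jac mu x y z.
Proof.
have b1 u : bilin (jac mu u) by split=> [v|v] a v1 v2; rewrite /jac; vring.
rewrite /jacobiator lfun_linE ?bilin_lfunE// => a u v.
apply/lfunP => y'; apply/lfunP => z'.
by rewrite !lfun_simp !bilin_lfunE// /jac; vring.
Qed.

(** The differential at [mu], in the direction [nu], of the quadratic map [jac]. *)
Definition jac_deriv mu nu x y z : W :=
  (nu x (mu y z) + mu x (nu y z)) + (nu y (mu z x) + mu y (nu z x))
  + (nu z (mu x y) + mu z (nu x y)).

Definition jacobiator_deriv mu nu : 'Hom(W, 'Hom(W, 'End(W))) :=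
  linfun (fun x => bilin_lfun (jac_deriv mu nu x)).

Lemma jacobiator_derivE mu nu x y z : jacobiator_deriv mu nu x y z = jac_deriv mu nu x y z.
Proof.
have b1 u : bilin (jac_deriv mu nu u) by split=> [v|v] a v1 v2; rewrite /jac_deriv; vring.
rewrite /jacobiator_deriv lfun_linE ?bilin_lfunE// => a u v.
apply/lfunP => y'; apply/lfunP => z'.
by rewrite !lfun_simp !bilin_lfunE// /jac_deriv; vring.
Qed.

(** [delta mu E] is the infinitesimal change of basis by [E], and [jac] is equivariant under changes
    of basis. Its derivative is thus the same infinitesimal action on [jac mu], which is linear in
    the Jacobiator. *)
Lemma jac_deriv_flow mu x y z : jac_deriv mu (flow_field mu) x y z =
  jac mu (flow_op mu x) y z + jac mu x (flow_op mu y) z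
  + jac mu x y (flow_op mu z) - flow_op mu (jac mu x y z).
Proof.
by rewrite /jac_deriv /jac !flow_fieldE /delta; move: (flow_op mu) => E; vring.
Qed.

Lemma vderive_jacobiator t (mu : R -> M) mu' : is_vderive t mu mu' ->
  is_vderive t (fun s => jacobiator (mu s)) (jacobiator_deriv (mu t) mu').
Proof.
move=> h; apply: vderive_hom => x; apply: vderive_hom => y; apply: vderive_hom => z.
rewrite jacobiator_derivE; under eq_fun do rewrite jacobiatorE.
have h1 u : is_vderive t (fun s => mu s u) (mu' u) by exact: vderive_homE.
have h2 u v : is_vderive t (fun s => mu s u v) (mu' u v) by exact: vderive_homE.
by apply: vderive_add; [apply: vderive_add|]; apply: vderive_happ.
Qed.

(** * Compatibility of the curvature tensors, the flow field and the Jacobiator with congruence *)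

Section FlowCongruence.
Variables (a b : R) (n : R -> R).
Local Notation "u == v" := (cong a b n u v).

Lemma cong_bracket (mu nu : R -> M) (u u' v v' : R -> W) : mu == nu -> u == u' -> v == v' ->
  (fun s => mu s (u s) (v s)) == (fun s => nu s (u' s) (v' s)).
Proof. by move=> h hu hv; apply: cong_happ => //; exact: cong_happ. Qed.

Lemma cong_metric (u u' : R -> W) y : u == u' ->
  (fun s => g (u s) y : R^o) == (fun s => g (u' s) y : R^o).
Proof. by apply: (cong_lin (h := fun u => g u y : R^o)); exact: glinl. Qed.

Lemma cong_nabla (mu nu : R -> M) x : mu == nu ->
  (fun s => nabla g (mu s) x) == (fun s => nabla g (nu s) x).
Proof.
move=> h; apply: cong_hom => y; apply: (cong_rep ig) => z.
apply: cong_ext (fun s _ => esym (nablaE ig _ _ _ _)) (fun s _ => esym (nablaE ig _ _ _ _)) _.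
have c u v w : (fun s => g (mu s u v) w : R^o) == (fun s => g (nu s u v) w : R^o).
  by apply: cong_metric; apply: cong_bracket => //; exact: cong_cst.
by apply: (@cong_scale _ _ _ _ R^o); apply: cong_add => //; exact: cong_sub.
Qed.

Lemma cong_nabla_app (mu nu : R -> M) u u' y : mu == nu -> u == u' ->
  (fun s => nabla g (mu s) (u s) y) == (fun s => nabla g (nu s) (u' s) y).
Proof.
move=> h hu; apply: (@cong_app _ _ _ _ _ _ (fun s x => nabla g (mu s) x y)
  (fun s x => nabla g (nu s) x y)) => //.
- by move=> s; exact: nabla_is_lin_app.
- by move=> s; exact: nabla_is_lin_app.
- by move=> x; apply: cong_homE; exact: cong_nabla.
Qed.

Lemma cong_ricci_tensor (mu nu : R -> M) y z : mu == nu ->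
  (fun s => ricci_tensor g (mu s) y z : R^o) == (fun s => ricci_tensor g (nu s) y z : R^o).
Proof.
move=> h; apply: cong_trace; apply: cong_hom => x.
have E mu0 : linfun (fun x => curvature g mu0 x y z) x =
    nabla g mu0 x (nabla g mu0 y z) - nabla g mu0 y (nabla g mu0 x z)
    - nabla g mu0 (mu0 x y) z.
  by rewrite lfun_linE ?curvatureE//; exact: curvature_is_lin1.
apply: cong_ext (fun s _ => esym (E _)) (fun s _ => esym (E _)) _.
apply: cong_sub; first apply: cong_sub.
- by apply: cong_happ; [exact: cong_nabla|apply: cong_homE; exact: cong_nabla].
- by apply: cong_happ; [exact: cong_nabla|apply: cong_homE; exact: cong_nabla].
- by apply: cong_nabla_app => //; apply: cong_bracket => //; exact: cong_cst.
Qed.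

Lemma cong_ricci_potential (mu nu : R -> M) (u u' : R -> W) : mu == nu -> u == u' ->
  (fun s => ricci_potential (mu s) (u s) : R^o) ==
  (fun s => ricci_potential (nu s) (u' s) : R^o).
Proof.
move=> h hu; apply: cong_sub; apply: cong_trace.
  by apply: cong_happ => //; apply: cong_lin => //; exact: is_lin_lfun.
apply: (cong_lin (h := fun A : 'End(W) => (J \o A)%VF)); last exact: cong_happ.
by move=> c A B; rewrite comp_lfunDr -comp_lfunZr.
Qed.

Lemma cong_flow_op (mu nu : R -> M) : mu == nu ->
  (fun s => flow_op (mu s)) == (fun s => flow_op (nu s)).
Proof.
move=> h; apply: cong_hom => x; apply: (cong_rep ig) => y.
have E mu0 : g (flow_op mu0 x) y = 2^-1 * ricci_potential mu0 (mu0 x (J y))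
    + 2^-1 * (ricci_tensor g mu0 x y - ricci_tensor g mu0 (J x) (J y)).
  rewrite /flow_op lfun_simp (gDl ig) ricci_acE; congr (_ + _).
  by rewrite g_chern_ricci_op chern_ricci_formE.
apply: cong_ext (fun s _ => esym (E _)) (fun s _ => esym (E _)) _.
apply: (@cong_add _ _ _ _ R^o); last first.
  by apply: (@cong_scale _ _ _ _ R^o); apply: cong_sub; exact: cong_ricci_tensor.
apply: (@cong_scale _ _ _ _ R^o).
by apply: cong_ricci_potential => //; apply: cong_bracket => //; exact: cong_cst.
Qed.

Lemma cong_flow_field (mu nu : R -> M) : mu == nu ->
  (fun s => flow_field (mu s)) == (fun s => flow_field (nu s)).
Proof.
move=> h; apply: cong_hom => x; apply: cong_hom => y.
apply: cong_ext (fun s _ => esym (flow_fieldE _ _ _)) (fun s _ => esym (flow_fieldE _ _ _)) _.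
have hE := cong_flow_op h; have hE' z := cong_homE z hE.
have hc z : cong a b n (fun=> z) (fun=> z : W) by exact: cong_cst.
apply: cong_sub; last by apply: cong_happ => //; exact: cong_bracket.
by apply: cong_add; exact: cong_bracket.
Qed.

Lemma cong_jac (mu nu : R -> M) (x y z x' y' z' : R -> W) : mu == nu ->
  x == x' -> y == y' -> z == z' ->
  (fun s => jac (mu s) (x s) (y s) (z s)) == (fun s => jac (nu s) (x' s) (y' s) (z' s)).
Proof.
move=> h hx hy hz; apply: cong_add; first apply: cong_add;
by apply: cong_bracket => //; exact: cong_bracket.
Qed.

Lemma cong_jacobiator (mu nu : R -> M) : mu == nu ->
  (fun s => jacobiator (mu s)) == (fun s => jacobiator (nu s)).
Proof.
move=> h; apply: cong_hom => x; apply: cong_hom => y; apply: cong_hom => z.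
apply: cong_ext (fun s _ => esym (jacobiatorE _ _ _ _)) (fun s _ => esym (jacobiatorE _ _ _ _)) _.
by apply: cong_jac => //; exact: cong_cst.
Qed.

Lemma cong_jacobiator_deriv (mu nu mu' nu' : R -> M) : mu == nu -> mu' == nu' ->
  (fun s => jacobiator_deriv (mu s) (mu' s)) == (fun s => jacobiator_deriv (nu s) (nu' s)).
Proof.
move=> h h'; apply: cong_hom => x; apply: cong_hom => y; apply: cong_hom => z.
apply: cong_ext (fun s _ => esym (jacobiator_derivE _ _ _ _ _)) (fun s _ => esym (jacobiator_derivE _ _ _ _ _)) _.
have hc w : cong a b n (fun=> w) (fun=> w : W) by exact: cong_cst.
apply: cong_add; first apply: cong_add; apply: cong_add;
by apply: cong_bracket => //; exact: cong_bracket.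
Qed.

Lemma cong_jac0 (mu : R -> M) (x y z : R -> W) : mu == mu ->
  (fun s => jacobiator (mu s)) == (fun=> 0) -> x == x -> y == y -> z == z ->
  (fun s => jac (mu s) (x s) (y s) (z s)) == (fun=> 0).
Proof.
move=> h hJ hx hy hz.
have := cong_happ (cong_happ (cong_happ hJ hx) hy) hz.
by apply: cong_ext => s _; rewrite ?jacobiatorE ?lfun_simp.
Qed.

Lemma cong_jac_deriv_flow (mu : R -> M) : mu == mu ->
  (fun s => jacobiator (mu s)) == (fun=> 0) ->
  (fun s => jacobiator_deriv (mu s) (flow_field (mu s))) == (fun=> 0).
Proof.
move=> h hJ; apply: cong_hom => x; apply: cong_hom => y; apply: cong_hom => z.
have hE := cong_flow_op h; have hE' w := cong_homE w hE.
have hc w : cong a b n (fun=> w) (fun=> w : W) by exact: cong_cst.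
have J0 := cong_jac0 h hJ.
have := cong_sub (cong_add (cong_add (J0 _ _ _ (hE' x) (hc y) (hc z))
  (J0 _ _ _ (hc x) (hE' y) (hc z))) (J0 _ _ _ (hc x) (hc y) (hE' z)))
  (cong_happ hE (J0 _ _ _ (hc x) (hc y) (hc z))).
apply: cong_ext => s _; first by rewrite jacobiator_derivE jac_deriv_flow.
by rewrite /= lfun0 subr0 !addr0 !zero_lfunE.
Qed.

End FlowCongruence.

(** * Preservation of the Jacobi identity and uniqueness for the bracket flow *)

Section FlowOnInterval.
Variable I : set R.
Hypotheses (itvI : is_interval I) (I0 : I 0).

(** The curve has to follow the flow field only modulo its own Jacobiator. This is all that is known
    a priori for the brackets built from a solution of the [theta] equation. *)
Lemma jacobi_preserved (mu mu' : R -> M) :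
  (forall t, I t -> is_vderive t mu (mu' t)) -> jacobiator (mu 0) = 0 ->
  (forall a b n, (forall s, a <= s <= b -> I s) ->
     cong a b n (fun s => jacobiator (mu s)) (fun=> 0) ->
     cong a b n mu' (fun s => flow_field (mu s))) ->
  forall t, I t -> jacobiator (mu t) = 0.
Proof.
move=> hd h0 hflow.
apply: (vanish itvI I0 h0 (fun t It => vderive_jacobiator (hd t It))).
move=> a b n abI hJ; have hmu := cong_vderive n (fun t ht => hd t (abI t ht)).
apply: cong_trans (cong_jac_deriv_flow hmu hJ).
by apply: cong_jacobiator_deriv => //; exact: hflow.
Qed.

(** Local Lipschitz continuity of the flow field appears as [cong_flow_field]: modulo the size of
    [mu - nu] the two fields coincide. *)
Lemma bracket_flow_unique (mu nu : R -> M) :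
  bracket_flow g J I mu -> bracket_flow g J I nu -> mu 0 = nu 0 ->
  forall t, I t -> mu t = nu t.
Proof.
move=> /bracket_flowP hmu /bracket_flowP hnu h0 t It; apply/eqP.
rewrite -subr_eq0; apply/eqP.
apply: (@vanish _ _ I (fun s => mu s - nu s)
  (fun s => flow_field (mu s) - flow_field (nu s))) It => //.
- by rewrite h0 subrr.
- move=> s Is; apply: vderive_add; first exact: hmu.
  by apply: (vderive_lin (h := -%R)) (hnu s Is); exact: is_lin_linear.
- move=> a b n abI hc.
  have cnu := cong_vderive n (fun s hs => hnu s (abI s hs)).
  have : cong a b n mu nu.
    by apply: (cong_ext _ _ (cong_add hc cnu)) => s _; rewrite ?subrK ?add0r.
  move=> /cong_flow_field h; have := cong_sub h (cong_reflr h).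
  by apply: cong_ext => // s _; exact: subrr.
Qed.

End FlowOnInterval.

(** * Isometric involutive automorphisms anticommuting with [J] *)

Section Reflection.
Variable sig : 'End(W).
Hypotheses (sigK : forall x, sig (sig x) = x).
Hypothesis gsig : forall x y, g (sig x) (sig y) = g x y.
Variable mu : M.
Hypothesis musig : forall x y, mu (sig x) (sig y) = sig (mu x y).

Lemma lftrace_conj (f h : 'End(W)) :
  (forall x, h (sig x) = sig (f x)) -> lftrace h = lftrace f.
Proof.
move=> hf; have -> : h = (sig \o (f \o sig))%VF.
  by apply/lfunP => x; rewrite !lfun_simp -hf sigK.
rewrite lftraceC; congr lftrace; apply/lfunP => x.
by rewrite !lfun_simp sigK.
Qed.

Lemma gsigl x y : g (sig x) y = g x (sig y).
Proof. by rewrite -gsig sigK. Qed.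

Lemma nabla_sig x y : nabla g mu (sig x) (sig y) = sig (nabla g mu x y).
Proof.
apply: (metric_ext ig) => z; rewrite -[z]sigK gsig !(nablaE ig) !musig.
by rewrite !gsig.
Qed.

Lemma curvature_sig x y z :
  curvature g mu (sig x) (sig y) (sig z) = sig (curvature g mu x y z).
Proof. by rewrite !curvatureE !(nabla_sig, musig); vring. Qed.

Lemma ricci_tensor_sig y z : ricci_tensor g mu (sig y) (sig z) = ricci_tensor g mu y z.
Proof.
apply: lftrace_conj => x.
have lc u v := lfun_linE (curvature_is_lin1 ig mu u v).
by rewrite !lc curvature_sig.
Qed.

Hypothesis Jsig : forall x, J (sig x) = - sig (J x).

Lemma ricci_ac_sig x : ricci_ac g J mu (sig x) = sig (ricci_ac g J mu x).
Proof.
apply: (metric_ext ig) => y; rewrite gsigl -{1}[y]sigK; move: (sig y) => z.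
have RN u v : ricci_tensor g mu (- u) v = - ricci_tensor g mu u v.
  exact: (is_linN ((ricci_tensor_bform ig mu).2 v)).
have RNr u v : ricci_tensor g mu u (- v) = - ricci_tensor g mu u v.
  exact: (is_linN ((ricci_tensor_bform ig mu).1 u)).
by rewrite !ricci_acE !Jsig RN RNr opprK !ricci_tensor_sig.
Qed.

(** Each trace contains [J] once, whence the sign. In [chern_ricci_op_sig] it cancels against the
    sign from the [J] that relates [omega] to [g]. *)
Lemma ricci_potential_sig u : ricci_potential mu (sig u) = - ricci_potential mu u.
Proof.
rewrite /ricci_potential.
have -> : lftrace (mu (J (sig u))) = - lftrace (mu (J u)).
  rewrite Jsig linearN; have := is_linN (@lftrace_is_lin R W); rewrite /= => ->.
  by congr (- _); apply: lftrace_conj => x; rewrite musig.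
have -> : lftrace (J \o mu (sig u))%VF = - lftrace (J \o mu u)%VF.
  have := is_linN (@lftrace_is_lin R W); rewrite /= => <-.
  apply: lftrace_conj => x.
  by rewrite !lfun_simp musig Jsig linearN.
by rewrite opprB addrC opprK.
Qed.

Lemma chern_ricci_op_sig x : chern_ricci_op g J mu (sig x) = sig (chern_ricci_op g J mu x).
Proof.
apply: (metric_ext ig) => y; rewrite gsigl -{1}[y]sigK; move: (sig y) => z.
rewrite !g_chern_ricci_op !chern_ricci_formE Jsig lfunN musig.
have := is_linN (ricci_potential_is_lin mu); rewrite /= => ->.
by rewrite ricci_potential_sig opprK.
Qed.

End Reflection.

(** Both [omega] and the Chern-Ricci form are antisymmetric, so the operator relating them is
    self-adjoint for [omega]. This makes the lower block of [P] the transpose of the upper one. *)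
Lemma chern_ricci_op_omega mu x y : (forall u, mu u u = 0) ->
  omega (chern_ricci_op g J mu x) y = omega x (chern_ricci_op g J mu y).
Proof.
move=> alt; rewrite [RHS]omega_anti !chern_ricci_opE !chern_ricci_formE.
rewrite (alternating_anti alt y x); have := is_linN (ricci_potential_is_lin mu).
by rewrite /= => ->; rewrite mulrN opprK.
Qed.

End AlmostHermitian.

(** * The double [V * V], its semidirect brackets and the block form of the operators *)

Section DoubleAlgebraTheory.
Variables (R : realType) (V : vectType R) (ip : V -> V -> R).
Hypothesis hip : inner_product ip.
Local Notation W := (V * V)%type.
Local Notation Theta := 'Hom(V, 'End(V)).
Local Notation G := (double_metric ip).
Local Notation J := (double_J V).
Local Notation sd := (semidirect_bracket ip).
Implicit Types (theta : Theta) (x y z : W) (X Y Z U : V).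

Lemma pair_split x : x = (x.1, 0) + (0, x.2) :> W.
Proof. by case: x => X Y; apply: injective_projections; rewrite /= ?addr0 ?add0r. Qed.

Lemma double_inner_product : inner_product G.
Proof.
split.
- split=> x a y z; rewrite /double_metric /= !(metric_lin hip);
    rewrite -[RHS]/(_ + _ : R) -[X in _ = X + _]/(_ * _ : R); ring.
- by move=> x y; rewrite /double_metric !(metricC hip x.1) (metricC hip x.2).
have [_ _ pos] := hip.
have ge0 X : 0 <= ip X X.
  by have [->|/pos/ltW//] := eqVneq X 0; rewrite (g0l hip).
move=> [X Y] nz; rewrite /double_metric /=.
have [X0|/pos h] := eqVneq X 0; last by rewrite ltr_pwDl.
have [Y0|/pos h] := eqVneq Y 0; last by rewrite ltr_wpDl.
by move: nz; rewrite X0 Y0 eqxx.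
Qed.

Lemma double_JE x : J x = (x.2, - x.1).
Proof.
rewrite /double_J lfun_linE// => a u v; apply: injective_projections => //=.
by rewrite opprD scalerN.
Qed.

Lemma double_JJ x : J (J x) = - x.
Proof. by rewrite !double_JE; case: x. Qed.

Lemma double_metric_J x y : G (J x) (J y) = G x y.
Proof. by rewrite !double_JE /double_metric /= !(metric_lin hip) opprK addrC. Qed.

Lemma omegaE x y : fundamental_form G J x y = ip x.2 y.1 - ip x.1 y.2.
Proof. by rewrite /fundamental_form double_JE /double_metric /= (gNl hip). Qed.

Lemma ip_ext X Y : (forall Z, ip X Z = ip Y Z) -> X = Y.
Proof. exact: (metric_ext hip). Qed.

Lemma base_bracketE theta X Z U :
  ip (base_bracket ip theta X Z) U = - ip Z (theta X U) + ip X (theta Z U).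
Proof. by rewrite /base_bracket !(metric_lin hip) !(adjointE hip). Qed.

Lemma base_bracket_bilin theta : bilin (base_bracket ip theta).
Proof.
split=> [X|Z] a Y Y'; apply: ip_ext => U /=;
  rewrite [RHS](gDl hip) [X in _ = X + _](gZl hip) !base_bracketE;
  rewrite !(lfun_lin, lfun_simp) !(metric_lin hip); ring.
Qed.

Lemma sdE theta x z : sd theta x z =
  (base_bracket ip theta x.1 z.1, theta x.1 z.2 - theta z.1 x.2).
Proof.
rewrite /semidirect_bracket.
pose F x z : W := (base_bracket ip theta x.1 z.1, theta x.1 z.2 - theta z.1 x.2).
have [l1 l2] := base_bracket_bilin theta.
rewrite -[linfun _]/(bilin_lfun F) bilin_lfunE//; split=> [u|u] a v w;
  apply: injective_projections; rewrite /F /=.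
- exact: l1.
- by vring.
- exact: l2.
- by vring.
Qed.

Lemma sd_is_lin : is_lin sd.
Proof.
move=> a t t'; apply/lfunP => x; apply/lfunP => z.
rewrite !lfun_simp !sdE; apply: injective_projections => /=; last by vring.
apply: ip_ext => U.
rewrite [RHS](gDl hip) [X in _ = X + _](gZl hip) !base_bracketE.
by rewrite !(lfun_simp, metric_lin hip); ring.
Qed.

Lemma base_bracket_alt theta X : base_bracket ip theta X X = 0.
Proof. by rewrite /base_bracket addNr. Qed.

Lemma sd_alt theta x : sd theta x x = 0.
Proof. by rewrite sdE base_bracket_alt subrr. Qed.

Definition double_reflection : 'End(W) := linfun (fun x : W => (x.1, - x.2)).

Lemma double_reflectionE x : double_reflection x = (x.1, - x.2).
Proof.
rewrite /double_reflection lfun_linE// => a u v; apply: injective_projections => //=.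
by rewrite opprD scalerN.
Qed.

Lemma double_reflectionK x : double_reflection (double_reflection x) = x.
Proof. by rewrite !double_reflectionE /= opprK; case: x. Qed.

Lemma double_metric_sig x y : G (double_reflection x) (double_reflection y) = G x y.
Proof. by rewrite !double_reflectionE /double_metric /= !(metric_lin hip) opprK. Qed.

Lemma double_J_sig x : J (double_reflection x) = - double_reflection (J x).
Proof. by rewrite !(double_JE, double_reflectionE); apply: injective_projections; rewrite /= ?opprK. Qed.

(** The bracket is graded modulo 2, with the first factor even and the abelian second factor odd;
    the reflection is the sign of this grading. *)
Lemma sd_sig theta x z :
  sd theta (double_reflection x) (double_reflection z) = double_reflection (sd theta x z).
Proof.
rewrite !sdE !double_reflectionE /=; congr pair.
by rewrite !linearN /= opprB opprK addrC.
Qed.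

Lemma block_diagE (A B : 'End(V)) x : block_diag A B x = (A x.1, B x.2).
Proof.
rewrite /block_diag lfun_linE// => a u v.
by apply: injective_projections; rewrite /= is_lin_lfun.
Qed.

Lemma ul_blockE (E : 'End(W)) X : ul_block E X = (E (X, 0)).1.
Proof.
rewrite /ul_block lfun_linE// => a u v.
rewrite (_ : (a *: u + v, 0) = a *: (u, 0) + (v, 0) :> W); first by rewrite is_lin_lfun.
by apply: injective_projections; rewrite /= ?scaler0 ?addr0.
Qed.

Lemma self_opp0 (u : V) : u = - u -> u = 0.
Proof.
move/eqP; rewrite -addr_eq0 -mulr2n -scaler_nat scaler_eq0 pnatr_eq0 /=.
by move/eqP.
Qed.

(** Such an [E] preserves the eigenspaces of the reflection, which are the two factors. *)
Lemma sig_commuting_block (E : 'End(W)) x :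
  (forall x, E (double_reflection x) = double_reflection (E x)) ->
  E x = ((E (x.1, 0)).1, (E (0, x.2)).2).
Proof.
move=> h; rewrite {1}(pair_split x) linearD.
have h1 : (E (x.1, 0)).2 = 0.
  apply: self_opp0; have := h (x.1, 0); rewrite !double_reflectionE /= oppr0.
  by move=> {1}->.
have h2 : (E (0, x.2)).1 = 0.
  apply: self_opp0; have := h (0, x.2); rewrite !double_reflectionE /=.
  have -> : (0, - x.2) = - (0, x.2) :> W by apply: injective_projections; rewrite /= ?oppr0.
  by rewrite linearN => /(congr1 fst) /= {1}<-.
by apply: injective_projections; rewrite /= ?h1 ?h2 ?addr0 ?add0r.
Qed.

Lemma double_P_block theta :
  double_P ip theta = block_diag (P1 ip theta) (adjoint ip (P1 ip theta)).
Proof.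
apply/lfunP => x; rewrite block_diagE.
have hs := chern_ricci_op_sig double_inner_product double_JJ double_metric_J
  double_reflectionK double_metric_sig (sd_sig theta) double_J_sig.
rewrite (sig_commuting_block x hs) ul_blockE; congr pair.
apply: ip_ext => Z; rewrite (adjointE hip) ul_blockE.
(* As [omega] pairs the first factor with the second, self-adjointness for [omega] relates the two
   blocks by transposition with respect to [ip]. *)
have := chern_ricci_op_omega double_inner_product double_JJ double_metric_J
  (0, x.2) (Z, 0) (sd_alt theta).
by rewrite !omegaE /= (g0l hip) (g0r hip) !subr0.
Qed.

Lemma ip_S1 theta X Z : ip (S1 ip theta X) Z =
  2^-1 * (ricci_tensor G (sd theta) (X, 0) (Z, 0)
          - ricci_tensor G (sd theta) (J (X, 0)) (J (Z, 0))).
Proof.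
rewrite ul_blockE -(ricci_acE double_inner_product double_JJ double_metric_J).
by rewrite /double_metric /= (g0r hip) addr0.
Qed.

Lemma double_ricci_ac_block theta :
  double_ricci_ac ip theta = block_diag (S1 ip theta) (- S1 ip theta).
Proof.
apply/lfunP => x; rewrite block_diagE.
have hs := ricci_ac_sig double_inner_product double_JJ double_metric_J
  double_reflectionK double_metric_sig (sd_sig theta) double_J_sig.
rewrite (sig_commuting_block x hs) ul_blockE; congr pair.
apply: ip_ext => Z; rewrite opp_lfunE (gNl hip) ip_S1.
transitivity (G (ricci_ac G J (sd theta) (0, x.2)) (0, Z)).
  by rewrite /double_metric /= (g0r hip) add0r.
rewrite (ricci_acE double_inner_product double_JJ double_metric_J).
(* [J] exchanges the factors, and the anti-invariant part of the Ricci tensor changes sign when [J]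
   is applied to both arguments. *)
have -> : (0, x.2) = - J (x.2, 0).
  by rewrite double_JE; apply: injective_projections; rewrite /= ?oppr0 ?opprK.
have -> : (0, Z) = - J (Z, 0).
  by rewrite double_JE; apply: injective_projections; rewrite /= ?oppr0 ?opprK.
have rb := ricci_tensor_bform double_inner_product (sd theta).
have RN u v : ricci_tensor G (sd theta) (- u) (- v) = ricci_tensor G (sd theta) u v.
  by rewrite (is_linN (rb.1 _)) (is_linN (rb.2 _)) opprK.
by rewrite !lfunN !double_JJ !opprK !RN; ring.
Qed.

Definition flow_A theta : 'End(V) := P1 ip theta + S1 ip theta.
Definition flow_D theta : 'End(V) := adjoint ip (P1 ip theta) - S1 ip theta.

Lemma flow_opE theta x :
  flow_op G J (sd theta) x = (flow_A theta x.1, flow_D theta x.2).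
Proof.
rewrite /flow_op add_lfunE.
have := double_P_block theta; rewrite /double_P => ->.
have := double_ricci_ac_block theta; rewrite /double_ricci_ac => ->.
by rewrite !block_diagE /flow_A /flow_D !lfun_simp.
Qed.

Definition theta_field theta : Theta :=
  linfun (fun X => theta (flow_A theta X) + lf_commutator (theta X) (flow_D theta)).

Lemma theta_field_lin theta :
  is_lin (fun X => theta (flow_A theta X) + lf_commutator (theta X) (flow_D theta)).
Proof.
move=> a X Y; apply/lfunP => Z; move: (flow_A theta) (flow_D theta) => A D.
by rewrite /lf_commutator; vring.
Qed.

Lemma theta_fieldE theta X Y : theta_field theta X Y =
  theta (flow_A theta X) Y
  + (theta X (flow_D theta Y) - flow_D theta (theta X Y)).
Proof.
rewrite /theta_field (lfun_linE (@theta_field_lin theta)).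
by move: (flow_A theta) (flow_D theta) => A D; rewrite /lf_commutator !lfun_simp.
Qed.

Lemma theta_flowP (I : set R) (theta : R -> Theta) : theta_flow ip I theta <->
  forall t, I t -> is_vderive t theta (theta_field (theta t)).
Proof.
split=> h t It.
  apply: vderive_hom => X; rewrite /theta_field (lfun_linE (@theta_field_lin _)).
  exact: h.
move=> X; have := vderive_homE X (h t It).
by rewrite /theta_field (lfun_linE (@theta_field_lin _)).
Qed.

(** A left inverse of [sd] defined on all products, so that [sd (extract mu)] is a linear projection
    onto the semidirect brackets. *)
Definition extract (mu : 'Hom(W, 'End(W))) : Theta :=
  bilin_lfun (fun X Y => (mu (X, 0) (0, Y)).2).

Lemma pair0_lin : is_lin (fun X : V => (X, 0) : W).
Proof. by move=> a u v; apply: injective_projections; rewrite /= ?scaler0 ?addr0. Qed.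

Lemma pair0_linr : is_lin (fun X : V => (0, X) : W).
Proof. by move=> a u v; apply: injective_projections; rewrite /= ?scaler0 ?addr0. Qed.

Lemma extractE mu X Y : extract mu X Y = (mu (X, 0) (0, Y)).2.
Proof.
rewrite /extract bilin_lfunE//; split=> [Z|Z] a u v.
  by rewrite pair0_linr is_lin_lfun.
by rewrite pair0_lin bracket_is_linl.
Qed.

Lemma extract_is_lin : is_lin extract.
Proof.
by move=> a mu nu; apply/lfunP => X; apply/lfunP => Y; rewrite !(extractE, lfun_simp).
Qed.

Lemma extractK theta : extract (sd theta) = theta.
Proof.
apply/lfunP => X; apply/lfunP => Y.
by rewrite extractE sdE /= lfun0 subr0.
Qed.

(** The action component of [delta] for a block diagonal operator is exactly the right-hand side of
    the [theta] equation; the defect is confined to the first component. *)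
Lemma flow_field_snd theta x z :
  (flow_field G J (sd theta) x z).2 = (sd (theta_field theta) x z).2.
Proof.
rewrite flow_fieldE /delta !flow_opE !sdE /= !theta_fieldE.
by move: (flow_A theta) (flow_D theta) => A D; vring.
Qed.

Lemma extract_flow_field theta :
  extract (flow_field G J (sd theta)) = theta_field theta.
Proof.
apply/lfunP => X; apply/lfunP => Y.
by rewrite extractE flow_field_snd -extractE extractK.
Qed.

Definition jac_trace (mu : 'Hom(W, 'End(W))) y z : R :=
  lftrace (linfun (fun x => jac mu x y z)).

(** The skew part of [S1], written through traces of the Jacobiator so that its linear dependence on
    the latter is visible. *)
Definition S1_skew theta X Z : R :=
  2^-1 * (jac_trace (sd theta) (X, 0) (Z, 0)
          - jac_trace (sd theta) (J (X, 0)) (J (Z, 0))).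

Lemma S1_skewE theta X Z :
  ip (S1 ip theta X) Z - ip X (S1 ip theta Z) = S1_skew theta X Z.
Proof.
rewrite (metricC hip X) !ip_S1 /S1_skew /jac_trace.
rewrite -!(ricci_tensor_anti double_inner_product _ _ (sd_alt theta)); ring.
Qed.

(** Since [J (U, 0) = (0, - U)], the bracket entering the Chern-Ricci form lies in the abelian
    ideal. *)
Lemma ip_P1 theta X U :
  ip (P1 ip theta X) U = - (2^-1 * ricci_potential J (sd theta) (0, theta X U)).
Proof.
transitivity (G (chern_ricci_op G J (sd theta) (X, 0)) (U, 0)).
  by rewrite ul_blockE /double_metric /= (g0r hip) addr0.
rewrite (g_chern_ricci_op double_inner_product double_JJ double_metric_J).
rewrite chern_ricci_formE double_JE /= sdE /= lfunN.
have -> : (base_bracket ip theta X 0, - theta X U - theta 0 0)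
    = - (0, theta X U) :> W.
  apply: injective_projections; rewrite /= ?lfun0 ?subr0//.
  by rewrite (is_lin0 ((base_bracket_bilin theta).1 X)) oppr0.
have := is_linN (ricci_potential_is_lin J (sd theta)); rewrite /= => ->.
by rewrite mulrN.
Qed.

(** The bilinear form of [D^t + A], whose vanishing would make [base_bracket] compatible with the
    two infinitesimal actions. *)
Lemma flow_A_D theta X U : ip X (flow_D theta U) + ip (flow_A theta X) U =
  - ricci_potential J (sd theta) (0, theta X U) + S1_skew theta X U.
Proof.
rewrite -S1_skewE /flow_A /flow_D !lfun_simp !(metric_lin hip) (adjointEr hip) !ip_P1.
lra.
Qed.

Lemma jac_sd theta X Z U : jac (sd theta) (X, 0) (Z, 0) (0, U) =
  (0, theta X (theta Z U) - theta Z (theta X U)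
      - theta (base_bracket ip theta X Z) U).
Proof.
have bl Y : base_bracket ip theta Y 0 = 0.
  exact: (is_lin0 ((base_bracket_bilin theta).1 Y)).
have br Y : base_bracket ip theta 0 Y = 0.
  exact: (is_lin0 ((base_bracket_bilin theta).2 Y)).
rewrite /jac !sdE /= !lfun0 !zero_lfunE.
apply: injective_projections; rewrite /= ?(bl, br) ?lfun0 ?zero_lfunE ?addr0 ?subr0//.
by rewrite !sub0r lfunN.
Qed.

(* The first components of [sd (theta_field theta)] and of the bracket flow
   field agree up to terms that are linear in the Jacobiator. *)
Lemma field_defect theta x z U :
  ip ((sd (theta_field theta) x z).1 - (flow_field G J (sd theta) x z).1) U =
  ricci_potential J (sd theta) (jac (sd theta) (x.1, 0) (z.1, 0) (0, U))
  + S1_skew theta (base_bracket ip theta x.1 z.1) U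
  + S1_skew theta z.1 (theta x.1 U) - S1_skew theta x.1 (theta z.1 U).
Proof.
move: x z => [X ?] [Z ?] /=; set l := base_bracket ip theta X Z.
(* After expansion, [A] and [D] occur only through the form of [D^t + A], evaluated at three pairs
   of vectors. *)
transitivity ((ip l (flow_D theta U) + ip (flow_A theta l) U)
  + (ip Z (flow_D theta (theta X U)) + ip (flow_A theta Z) (theta X U))
  - (ip X (flow_D theta (theta Z U)) + ip (flow_A theta X) (theta Z U))).
  rewrite flow_fieldE /delta !flow_opE !sdE /= /l.
  have hF := base_bracketE (theta_field theta) X Z U.
  rewrite !theta_fieldE in hF; have hB := base_bracketE theta.
  move: (base_bracket ip (theta_field theta) X Z) hF => F hF.
  move: (base_bracket ip theta) hB (flow_A theta) (flow_D theta) hF => B hB A D hF.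
  by rewrite !(metric_lin hip) hF !hB !(metric_lin hip); ring.
(* By linearity the three potentials combine into that of the curvature of [theta], which [jac_sd]
   identifies as a value of the Jacobiator. *)
rewrite !flow_A_D jac_sd -/l.
have rD := is_linD (ricci_potential_is_lin J (sd theta)).
have rN := is_linN (ricci_potential_is_lin J (sd theta)).
have -> : (0, theta X (theta Z U) - theta Z (theta X U) - theta l U) =
    (0, theta X (theta Z U)) - (0, theta Z (theta X U)) - (0, theta l U) :> W.
  by apply: injective_projections; rewrite /= ?subr0.
rewrite rD rN rD rN /=.
rewrite -[X in _ = X + _ + _ - _]/(_ - _ - _ : R); ring.
Qed.

Lemma field_cong (theta : R -> Theta) a b n : cong a b n theta theta ->
  cong a b n (fun s => jacobiator (sd (theta s))) (fun=> 0) ->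
  cong a b n (fun s => sd (theta_field (theta s)))
             (fun s => flow_field G J (sd (theta s))).
Proof.
move=> ht hJ.
have hm : cong a b n (fun s => sd (theta s)) (fun s => sd (theta s)).
  by apply: cong_lin ht; exact: sd_is_lin.
have J0 := cong_jac0 hm hJ.
have hc (w : W) : cong a b n (fun=> w) (fun=> w) by exact: cong_cst.
have hF := cong_flow_field double_inner_product double_JJ double_metric_J hm.
suff h : cong a b n (fun s => sd (theta_field (theta s)) - flow_field G J (sd (theta s)))
    (fun=> 0).
  by have := cong_add h hF; apply: cong_ext => s _; rewrite ?subrK ?add0r.
have T0 (y z : R -> W) : cong a b n y y -> cong a b n z z ->
    cong a b n (fun s => jac_trace (sd (theta s)) (y s) (z s) : R^o) (fun=> 0).
  move=> hy hz.
  have : cong a b n (fun s => linfun (fun x => jac (sd (theta s)) x (y s) (z s)))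
      (fun=> 0 : 'End(W)).
    apply: cong_hom => x.
    have := J0 _ _ _ (hc x) hy hz; apply: cong_ext => s _; last by rewrite zero_lfunE.
    rewrite lfun_linE// => c u v.
    by rewrite -!jacobiatorE is_lin_lfun !lfun_simp.
  move=> /cong_trace; apply: cong_ext => // s _.
  exact: (is_lin0 (@lftrace_is_lin R W)).
have S0 (X Z : R -> V) : cong a b n X X -> cong a b n Z Z ->
    cong a b n (fun s => S1_skew (theta s) (X s) (Z s) : R^o) (fun=> 0).
  move=> hX hZ.
  have hx := cong_lin pair0_lin hX; have hz := cong_lin pair0_lin hZ.
  have hJx := cong_lin (is_lin_lfun J) hx; have hJz := cong_lin (is_lin_lfun J) hz.
  have := cong_scale 2^-1 (cong_sub (T0 _ _ hx hz) (T0 _ _ hJx hJz)).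
  by apply: cong_ext => // s _; rewrite subrr scaler0.
apply: cong_hom => x; apply: cong_hom => z; apply: (cong_rep double_inner_product) => y.
have E t : G ((sd (theta_field t) - flow_field G J (sd t)) x z) y =
    ip ((sd (theta_field t) x z).1 - (flow_field G J (sd t) x z).1) y.1.
  by rewrite !lfun_simp /double_metric /= flow_field_snd subrr (g0l hip) addr0.
have hcV (w : V) : cong a b n (fun=> w) (fun=> w) by exact: cong_cst.
have ht2 X U : cong a b n (fun s => theta s X U) (fun s => theta s X U).
  by apply: cong_homE; exact: cong_homE.
have hl : cong a b n (fun s => base_bracket ip (theta s) x.1 z.1)
    (fun s => base_bracket ip (theta s) x.1 z.1).
  have := cong_lin (is_lin_fst (@is_lin_id R W)) (cong_bracket hm (hc x) (hc z)).
  by apply: cong_ext => s _; rewrite sdE.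
have h1 : cong a b n (fun s => ricci_potential J (sd (theta s))
    (jac (sd (theta s)) (x.1, 0) (z.1, 0) (0, y.1)) : R^o) (fun=> 0).
  have := cong_ricci_potential J hm (J0 _ _ _ (hc (x.1, 0)) (hc (z.1, 0)) (hc (0, y.1))).
  apply: cong_ext => // s _; exact: (is_lin0 (ricci_potential_is_lin J _)).
have := cong_sub (cong_add (cong_add h1 (S0 _ _ hl (hcV y.1)))
  (S0 _ _ (hcV z.1) (ht2 x.1 y.1))) (S0 _ _ (hcV x.1) (ht2 z.1 y.1)).
apply: cong_ext => s _; first by rewrite E field_defect.
by rewrite !lfun_simp (g0l double_inner_product) subr0 !addr0.
Qed.

(** The case of a constant curve on the one-point interval with [n = 0], where congruence means
    equality. *)
Lemma field_eq theta : jacobiator (sd theta) = 0 ->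
  sd (theta_field theta) = flow_field G J (sd theta).
Proof.
move=> hJ; have h00 : (0 : R) <= (0 : R) <= (0 : R) by rewrite lexx.
apply: (@cong_eq _ 0 0 (fun=> 0) _ (fun=> sd (theta_field theta))
  (fun=> flow_field G J (sd theta)) 0 h00 erefl).
apply: (@field_cong (fun=> theta)); first exact: cong_cst.
by rewrite hJ; exact: cong_cst.
Qed.

(** The transposes in [base_bracket] are chosen to make the terms cancel in pairs. *)
Lemma sd_closed theta x y z :
  fundamental_form G J (sd theta x y) z + fundamental_form G J (sd theta y z) x
  + fundamental_form G J (sd theta z x) y = 0.
Proof.
rewrite !omegaE !sdE /= !base_bracketE !(metric_lin hip).
have C X Y Z : ip (theta X Y) Z = ip Z (theta X Y) by exact: metricC.
rewrite !C.
ring.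
Qed.

Lemma sd_almost_kahler theta : jacobiator (sd theta) = 0 -> almost_kahler G J (sd theta).
Proof.
move=> hJ; split=> [x|x y z|x y z]; [exact: sd_alt| |exact: sd_closed].
by rewrite -[LHS]/(jac (sd theta) x y z) -jacobiatorE hJ !zero_lfunE.
Qed.

Lemma dual_repE (L : Theta) X : dual_rep ip L X = - adjoint ip (L X).
Proof.
rewrite /dual_rep lfun_linE// => a Y Z.
by rewrite is_lin_lfun (adjoint_is_lin hip) opprD scalerN.
Qed.

Lemma base_bracket_dual_rep (L : Theta) X Z :
  base_bracket ip (dual_rep ip L) X Z = L X Z - L Z X.
Proof.
have aN f : adjoint ip (- f) = - adjoint ip f by exact: (is_linN (adjoint_is_lin hip)).
by rewrite /base_bracket !dual_repE !aN !(adjointK hip) !opp_lfunE opprK.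
Qed.

(** Left symmetry says that [L] represents its own commutator bracket; the dual [th] is then a
    representation as well, and the first factor inherits the Jacobi identity. *)
Lemma jacobiator_dual_rep (L : Theta) : left_symmetric L ->
  jacobiator (sd (dual_rep ip L)) = 0.
Proof.
move=> hL; set th := dual_rep ip L.
have lb X Y Z : L (L X Y - L Y X) Z = L X (L Y Z) - L Y (L X Z).
  rewrite lfunD lfunN add_lfunE opp_lfunE.
  have -> : L X (L Y Z) = L Y (L X Z) - L (L Y X) Z + L (L X Y) Z.
    by rewrite -(hL X Y Z) subrK.
  by vring.
have rep X Y Z : th (base_bracket ip th X Y) Z = th X (th Y Z) - th Y (th X Z).
  apply: ip_ext => U; rewrite (gDl hip) (gNl hip) base_bracket_dual_rep.
  rewrite /th !dual_repE !opp_lfunE !(gNl hip, adjointE hip) lb !(metric_lin hip).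
  ring.
apply/lfunP => x; apply/lfunP => y; apply/lfunP => z.
rewrite jacobiatorE !zero_lfunE /jac !sdE /=; apply: injective_projections => /=.
  rewrite /th !base_bracket_dual_rep !lb; vring.
by rewrite !rep; vring.
Qed.

(** * Equivalence of the [theta] equation and the bracket flow *)

Section Flow.
Variables (I : set R) (itvI : is_interval I) (I0 : I 0).

Lemma theta_flow_jacobi (theta : R -> Theta) : theta_flow ip I theta ->
  jacobiator (sd (theta 0)) = 0 -> forall t, I t -> jacobiator (sd (theta t)) = 0.
Proof.
move=> /theta_flowP hd h0.
apply: (jacobi_preserved double_inner_product double_JJ double_metric_J itvI I0
  (fun t It => vderive_lin sd_is_lin (hd t It)) h0).
move=> a b n abI; apply: field_cong.
by apply: cong_vderive => s hs; exact: hd (abI s hs).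
Qed.

Lemma theta_flow_bracket_flow (theta : R -> Theta) : theta_flow ip I theta ->
  jacobiator (sd (theta 0)) = 0 -> bracket_flow G J I (fun t => sd (theta t)).
Proof.
move=> hf h0; apply/bracket_flowP => t It.
rewrite -field_eq; last exact: theta_flow_jacobi It.
by move/theta_flowP: hf => /(_ t It); apply: vderive_lin; exact: sd_is_lin.
Qed.

(* Modulo the ideal of functions dominated by [mu - sd (extract mu)], the curve
   [sd (extract mu)] satisfies the Jacobi identity along with [mu], so the
   bracket flow field at it is tangent to the space of semidirect brackets. *)
Lemma bracket_flow_semidirect (mu : R -> 'Hom(W, 'End(W))) theta0 :
  bracket_flow G J I mu -> mu 0 = sd theta0 -> jacobiator (sd theta0) = 0 ->
  forall t, I t -> mu t = sd (extract (mu t)).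
Proof.
move=> hf h0 hJ0 t It.
have hd := (bracket_flowP G J I mu).1 hf.
have hJ : forall t, I t -> jacobiator (mu t) = 0.
  apply: (jacobi_preserved double_inner_product double_JJ double_metric_J itvI I0 hd).
    by rewrite h0.
  move=> a b n abI _; apply: (cong_flow_field double_inner_product double_JJ double_metric_J).
  by apply: cong_vderive => s hs; exact: hd (abI s hs).
apply/eqP; rewrite -subr_eq0; apply/eqP.
apply: (@vanish _ _ I (fun s => mu s - sd (extract (mu s)))
  (fun s => flow_field G J (mu s) - sd (extract (flow_field G J (mu s))))) It => //.
- by rewrite h0 extractK subrr.
- move=> s Is; apply: vderive_add; first exact: hd.
  apply: (vderive_lin (h := fun nu => - sd (extract nu))) (hd s Is).
  by move=> a u v; rewrite extract_is_lin sd_is_lin opprD scalerN.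
move=> a b n abI hc.
have hmu : cong a b n mu mu by apply: cong_vderive => s hs; exact: hd (abI s hs).
have ex_lin : is_lin (fun nu => sd (extract nu)).
  by move=> c u v; rewrite extract_is_lin sd_is_lin.
have hth := cong_lin extract_is_lin hmu.
have hpi := cong_lin ex_lin hmu.
have hmp : cong a b n mu (fun s => sd (extract (mu s))).
  by apply: (cong_ext _ _ (cong_add hc hpi)) => s _; rewrite ?subrK ?add0r.
have hF := cong_flow_field double_inner_product double_JJ double_metric_J hmp.
(* The Jacobiator of [mu] vanishes, so that of its projection is O(n). *)
have hJp : cong a b n (fun s => jacobiator (sd (extract (mu s)))) (fun=> 0).
  have := cong_sym (cong_jacobiator hmp).
  by apply: cong_ext => // s hs; rewrite hJ//; exact: abI.
have hT := field_cong hth hJp.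
have hpF : cong a b n (fun s => sd (extract (flow_field G J (mu s))))
    (fun s => sd (theta_field (extract (mu s)))).
  have := cong_lin ex_lin hF; apply: cong_ext => // s _.
  by rewrite extract_flow_field.
(* Both terms of the derivative are congruent to the flow field at the projection of [mu], so their
   difference is O(n). *)
have := cong_sub hF (cong_trans hpF hT).
by apply: cong_ext => // s _; exact: subrr.
Qed.

Lemma bracket_flow_theta_flow (mu : R -> 'Hom(W, 'End(W))) theta0 :
  bracket_flow G J I mu -> mu 0 = sd theta0 -> jacobiator (sd theta0) = 0 ->
  theta_flow ip I (fun t => extract (mu t)).
Proof.
move=> hf h0 hJ0; apply/theta_flowP => t It.
have hd := (bracket_flowP G J I mu).1 hf t It.
have := vderive_lin extract_is_lin hd.
by rewrite {1}(bracket_flow_semidirect hf h0 hJ0 It) extract_flow_field.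
Qed.

End Flow.

End DoubleAlgebraTheory.

Lemma dot_inner_product (R : realType) (V : vectType R) (ip : {dot V for idfun}) :
  inner_product (ip : V -> V -> R).
Proof.
split.
- split=> x a u v; first by rewrite linearPr.
  by rewrite linearPl.
- by move=> x y; rewrite hermC expr0 mul1r.
- exact: neq0_dnorm_gt0.
Qed.

Theorem mainTheorem4 (R : realType) (V : vectType R) (ip : {dot V for idfun})
    (L : 'Hom(V, 'End(V))) (hL : left_symmetric L) :
  let theta0 := dual_rep ip L in
  (forall theta : 'Hom(V, 'End(V)),
     almost_kahler (double_metric ip) (double_J V) (semidirect_bracket ip theta) ->
     double_P ip theta = block_diag (P1 ip theta) (adjoint ip (P1 ip theta)) /\
     double_ricci_ac ip theta = block_diag (S1 ip theta) (- S1 ip theta)) /\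
  almost_kahler (double_metric ip) (double_J V) (semidirect_bracket ip theta0) /\
  (forall I : set R, open I -> is_interval I -> I 0 ->
     (forall theta : R -> 'Hom(V, 'End(V)),
        theta_flow ip I theta -> theta 0 = theta0 ->
        (forall t, I t ->
           almost_kahler (double_metric ip) (double_J V)
             (semidirect_bracket ip (theta t))) /\
        bracket_flow (double_metric ip) (double_J V) I
          (fun t => semidirect_bracket ip (theta t))) /\
     (forall mu : R -> 'Hom((V * V)%type, 'End((V * V)%type)),
        bracket_flow (double_metric ip) (double_J V) I mu ->
        mu 0 = semidirect_bracket ip theta0 ->
        (exists theta : R -> 'Hom(V, 'End(V)),
           theta_flow ip I theta /\ theta 0 = theta0) /\
        (forall theta : R -> 'Hom(V, 'End(V)),
           theta_flow ip I theta -> theta 0 = theta0 ->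
           forall t, I t -> mu t = semidirect_bracket ip (theta t)))).
Proof.
move=> theta0; have hip := dot_inner_product ip.
have J0 : jacobiator (semidirect_bracket ip theta0) = 0 by exact: jacobiator_dual_rep.
split=> [theta _|].
  by split; [exact: double_P_block|exact: double_ricci_ac_block].
split=> [|I _ itvI I0]; first exact: sd_almost_kahler.
split=> [theta hth th0|mu hmu mu0].
  have J0' : jacobiator (semidirect_bracket ip (theta 0)) = 0 by rewrite th0.
  split=> [t It|]; last exact: theta_flow_bracket_flow.
  by apply: sd_almost_kahler => //; exact: (theta_flow_jacobi hip itvI I0 hth).
split=> [|theta hth th0 t It].
  exists (fun t => extract (mu t)); split.
    exact: (bracket_flow_theta_flow hip itvI I0 hmu mu0 J0).
  by rewrite mu0 extractK.
have J0' : jacobiator (semidirect_bracket ip (theta 0)) = 0 by rewrite th0.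
apply: (bracket_flow_unique (double_inner_product hip) (double_JJ (V := V))
  (double_metric_J hip) itvI I0 hmu (theta_flow_bracket_flow hip itvI I0 hth J0')) It.
by rewrite mu0 th0.
Qed.
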